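(* Let $\Delta$ be an irreducible reduced root system not of type $A_n$, with highest root $\theta$, and let $S\subset\Pi_l$ be nonempty. Then the map $\eta\mapsto\theta-\eta$ is a bijection from the set of minimal elements of $\bigcap_{\alpha\in S}I(\alpha)_{\sf min}$ onto the set of maximal elements of $\Delta^+\setminus\bigcup_{\alpha\in S}I(\alpha)_{\sf max}$ (minimal/maximal with respect to $\preccurlyeq$).
   Context: $\Delta^+$, $\Pi$: positive and simple roots; $W$ the Weyl group, $(\ ,\ )$ a $W$-invariant inner product; $\mu\preccurlyeq\nu$ iff $\nu-\mu$ is a non-negative integral combination of simple roots. $\Delta^+_l$ is the set of long positive roots and $\Pi_l=\Pi\cap\Delta^+_l$. $\mathcal H=\{\gamma\in\Delta^+\mid(\gamma,\theta)>0\}$. An upper ideal of $\Delta^+$ is $I\subset\Delta^+$ with $\gamma\in I,\nu\in\Delta^+,\nu+\gamma\in\Delta^+\Rightarrow\nu+\gamma\in I$; it is abelian if $\gamma'+\gamma''\notin\Delta^+$ for all $\gamma',\gamma''\in I$. For $w\in W$, $N(w)=\{\gamma\in\Delta^+\mid w(\gamma)\in-\Delta^+\}$. For $\mu\in\Delta^+_l$, let $w_\mu$ be the unique minimal-length element of $W$ with $w_\mu(\theta)=\mu$ and $I(\mu)_{\sf min}=\{\theta\}\cup\{\theta-\gamma\mid\gamma\in N(w_\mu)\}$ (an abelian upper ideal contained in $\mathcal H$). It is known that among nonempty abelian upper ideals $I$ with $I\cap\mathcal H=I(\mu)_{\sf min}$ there is a unique maximal one, denoted $I(\mu)_{\sf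 max}$; the $I(\alpha)_{\sf max}$, $\alpha\in\Pi_l$, are exactly the maximal abelian upper ideals. *)

(* Defs.v *)
From HB Require Import structures.
From mathcomp Require Import all_boot all_order all_algebra.
Set Implicit Arguments. Unset Strict Implicit. Unset Printing Implicit Defensive.
Import Order.TTheory GRing.Theory Num.Theory.
Local Open Scope ring_scope.

(* Root systems in the Euclidean space R^n, realised as row vectors 'rV[R]_n
   with the standard inner product (which is W-invariant). *)
Section RootSystems.
Context {R : realFieldType} {n : nat}.
Notation vec := 'rV[R]_n.

Definition dot (u v : vec) : R := (u *m v^T) 0 0.

Definition cartan (b a : vec) : R := 2 * dot b a / dot a a.

Definition refl (a v : vec) : vec := v - cartan v a *: a.

Definition rows_of (s : seq vec) : 'M[R]_(size s, n) := \matrix_(i < size s) s`_i.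

Definition reduced_root_system (D : seq vec) : Prop :=
  [/\ uniq D, 0 \notin D & row_full (rows_of D)] /\
  [/\ (forall a b, a \in D -> b \in D -> refl a b \in D),
      (forall a b, a \in D -> b \in D -> exists z : int, cartan b a = z%:~R)
    & (forall a (c : R), a \in D -> c *: a \in D -> c = 1 \/ c = -1)].

Definition irreducible_rs (D : seq vec) : Prop :=
  forall P : pred vec, (exists2 a, a \in D & P a) -> (exists2 b, b \in D & ~~ P b) ->
    exists a b, [/\ a \in D, b \in D, P a, ~~ P b & dot a b != 0].

Definition is_base (D Pi : seq vec) : Prop :=
  [/\ uniq Pi, {subset Pi <= D}, row_free (rows_of Pi)
    & forall b, b \in D -> exists c : 'I_(size Pi) -> int,
        b = \sum_(i < size Pi) (c i)%:~R *: Pi`_i /\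
        ((forall i, 0 <= c i) \/ (forall i, c i <= 0))].

Definition posroot (D Pi : seq vec) (g : vec) : Prop :=
  g \in D /\ exists c : 'I_(size Pi) -> nat, g = \sum_(i < size Pi) (c i)%:R *: Pi`_i.

Definition rle (Pi : seq vec) (mu nu : vec) : Prop :=
  exists c : 'I_(size Pi) -> nat, nu - mu = \sum_(i < size Pi) (c i)%:R *: Pi`_i.

Definition highest_root (D Pi : seq vec) (th : vec) : Prop :=
  posroot D Pi th /\ forall g, posroot D Pi g -> rle Pi g th.

Definition long_root (D : seq vec) (g : vec) : Prop :=
  g \in D /\ forall b, b \in D -> dot b b <= dot g g.

(* Type A_r : the Dynkin diagram of the base is a path with simple edges *)
Definition typeA (Pi : seq vec) : Prop :=
  exists f : 'I_(size Pi) -> vec,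
    perm_eq [seq f i | i <- enum 'I_(size Pi)] Pi /\
    forall i j : 'I_(size Pi), i != j ->
      cartan (f i) (f j) * cartan (f j) (f i) =
        (if (i.+1 == j :> nat) || (j.+1 == i :> nat) then 1 else 0).

Definition actw (s : seq vec) (v : vec) : vec := foldr refl v s.

Definition inW (D : seq vec) (w : vec -> vec) : Prop :=
  exists s : seq vec, {subset s <= D} /\ forall v, w v = actw s v.

Definition simple_word (Pi : seq vec) (w : vec -> vec) (k : nat) : Prop :=
  exists s : seq vec, [/\ size s = k, {subset s <= Pi} & forall v, w v = actw s v].

Definition min_elt (D Pi : seq vec) (th mu : vec) (w : vec -> vec) : Prop :=
  [/\ inW D w, w th = mu &
      exists k, simple_word Pi w k /\
        forall w' k', inW D w' -> w' th = mu -> simple_word Pi w' k' -> (k <= k')%N].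

Definition Ninv (D Pi : seq vec) (w : vec -> vec) (g : vec) : Prop :=
  posroot D Pi g /\ posroot D Pi (- w g).

Definition Imin (D Pi : seq vec) (th mu : vec) (x : vec) : Prop :=
  x = th \/ exists w, min_elt D Pi th mu w /\ exists2 g, Ninv D Pi w g & x = th - g.

Definition Hset (D Pi : seq vec) (th : vec) (g : vec) : Prop :=
  posroot D Pi g /\ 0 < dot g th.

Definition upper_ideal (D Pi : seq vec) (I : vec -> Prop) : Prop :=
  (forall g, I g -> posroot D Pi g) /\
  forall g nu, I g -> posroot D Pi nu -> posroot D Pi (nu + g) -> I (nu + g).

Definition abelian_ideal (D Pi : seq vec) (I : vec -> Prop) : Prop :=
  forall g1 g2, I g1 -> I g2 -> ~ posroot D Pi (g1 + g2).

Definition Imax_cand (D Pi : seq vec) (th mu : vec) (I : vec -> Prop) : Prop :=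
  [/\ exists g, I g, upper_ideal D Pi I, abelian_ideal D Pi I
    & forall x, (I x /\ Hset D Pi th x) <-> Imin D Pi th mu x].

(* I(mu)_max : the unique maximal candidate, i.e. the union of all candidates *)
Definition Imax (D Pi : seq vec) (th mu : vec) (x : vec) : Prop :=
  exists I, Imax_cand D Pi th mu I /\ I x.

Definition minimal_in (Pi : seq vec) (A : vec -> Prop) (x : vec) : Prop :=
  A x /\ forall y, A y -> rle Pi y x -> y = x.

Definition maximal_in (Pi : seq vec) (A : vec -> Prop) (x : vec) : Prop :=
  A x /\ forall y, A y -> rle Pi x y -> y = x.

End RootSystems.

(* Main.v *)
(* Let [w] be a shortest element with [w th = mu], [mu] simple. Roots orthogonal to
   [th] keep their sign under [w], so [Imin] is the set of [x] in [Hset] with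
   [w x > 0]; since [mu] is not a sum of two positive roots, [Imin] contains
   exactly one of [x] and [th - x] for every [x <> th] in [Hset]. [Imax] consists
   of the positive roots all of whose upper bounds in [Hset] lie in [Imin]: this
   set is abelian because a root that is a sum of two of its members could be
   raised, keeping both summands in the set, until the sum is [th].
   Hence [x |-> th - x] exchanges the intersection of the [Imin] with the part of
   the complement of the union of the [Imax] that lies in [Hset], and it remains
   to see that a maximal element of this complement lies in [Hset]. Outside type
   A there is a single simple root [a] not orthogonal to [th], with coefficient 2
   in [th]: a coefficient 1 forces the diagram to be a path with simple edges. As
   the diagram is a tree, a positive root orthogonal to [th] has a least upper
   neighbour in [Hset], and this one root witnesses non-membership in every
   [Imax] at once. *)
Require Import Defs.
From HB Require Import structures.
From mathcomp Require Import all_boot all_order all_algebra.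
From mathcomp Require Import zify ring lra.
Import Order.TTheory GRing.Theory Num.Theory.
Local Open Scope ring_scope.

Set Implicit Arguments. Unset Strict Implicit. Unset Printing Implicit Defensive.

(** * Integers in an ordered field *)

Section Integrality.
Context {R : realFieldType}.
Implicit Types x y : R.

Definition isint x := exists z : int, x = z%:~R.

Lemma isint0 : isint 0. Proof. by exists 0. Qed.
Lemma isint1 : isint 1. Proof. by exists 1. Qed.

Lemma isintN x : isint x -> isint (- x).
Proof. by case=> z ->; exists (- z); rewrite rmorphN. Qed.

Lemma isintD x y : isint x -> isint y -> isint (x + y).
Proof. by case=> z -> [t ->]; exists (z + t); rewrite rmorphD. Qed.

Lemma isintB x y : isint x -> isint y -> isint (x - y).
Proof. by move=> hx hy; apply: isintD => //; apply: isintN. Qed.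

Lemma isint_sum (I : finType) (F : I -> R) :
  (forall i, isint (F i)) -> isint (\sum_i F i).
Proof.
by move=> hF; elim/big_ind: _ => [|x y|i _]; [exact: isint0 | exact: isintD | ].
Qed.

Lemma isint_ge1 x : isint x -> 0 < x -> 1 <= x.
Proof. by case=> z ->; rewrite ltr0z ler1z gtz0_ge1. Qed.

Lemma isint_ge2 x : isint x -> 0 < x -> x != 1 -> 2 <= x.
Proof.
move=> hx x0 x1; have h1 := isint_ge1 hx x0.
have x1' : 0 < x - 1 by rewrite subr_gt0 lt_def x1.
by have := isint_ge1 (isintB hx isint1) x1'; lra.
Qed.

Lemma isint_natP x : isint x -> 0 <= x -> exists k : nat, x = k%:R.
Proof. by case=> -[k|k] ->; [exists k | rewrite ler0z]. Qed.

Lemma isint_bound x : isint x -> exists k : nat, x <= k%:R.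
Proof.
case=> z ->; exists `|z|%N.
by rewrite -[`|z|%:R]/(`|z|%N%:Z%:~R) ler_int abszE ler_norm.
Qed.

End Integrality.

(** * Reflections *)

Section Euclid.
Context {R : realFieldType} {n : nat}.
Implicit Types (u v a b : 'rV[R]_n) (c : R).

Lemma dotE u v : dot u v = \sum_j u 0 j * v 0 j.
Proof. by rewrite /dot mxE; apply: eq_bigr => j _; rewrite mxE. Qed.

Lemma dotC u v : dot u v = dot v u.
Proof. by rewrite !dotE; apply: eq_bigr => j _; rewrite mulrC. Qed.

Lemma dotDl u v a : dot (u + v) a = dot u a + dot v a.
Proof. by rewrite /dot mulmxDl mxE. Qed.

Lemma dotZl c u a : dot (c *: u) a = c * dot u a.
Proof. by rewrite /dot -scalemxAl mxE. Qed.

Lemma dotNl u a : dot (- u) a = - dot u a.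
Proof. by rewrite -scaleN1r dotZl mulN1r. Qed.

Lemma dotBl u v a : dot (u - v) a = dot u a - dot v a.
Proof. by rewrite dotDl dotNl. Qed.

Lemma dotDr u v a : dot a (u + v) = dot a u + dot a v.
Proof. by rewrite !(dotC a) dotDl. Qed.

Lemma dotZr c u a : dot a (c *: u) = c * dot a u.
Proof. by rewrite !(dotC a) dotZl. Qed.

Lemma dotNr u a : dot a (- u) = - dot a u.
Proof. by rewrite !(dotC a) dotNl. Qed.

Lemma dotBr u v a : dot a (u - v) = dot a u - dot a v.
Proof. by rewrite !(dotC a) dotBl. Qed.

Lemma dot0l a : dot 0 a = 0.
Proof. by rewrite -(scale0r 0) dotZl mul0r. Qed.

Lemma dot_suml (I : finType) (P : pred I) (F : I -> 'rV[R]_n) a :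
  dot (\sum_(i | P i) F i) a = \sum_(i | P i) dot (F i) a.
Proof.
elim/big_rec2: _ => [|i x y _ <-]; first by rewrite dot0l.
by rewrite dotDl.
Qed.

Lemma dot_ge0 u : 0 <= dot u u.
Proof. by rewrite dotE; apply: sumr_ge0 => j _; rewrite -expr2 sqr_ge0. Qed.

Lemma dot_eq0 u : (dot u u == 0) = (u == 0).
Proof.
apply/eqP/eqP => [h|->]; last by rewrite dot0l.
apply/rowP => j; rewrite mxE; move: h; rewrite dotE => h.
have h0 i : true -> 0 <= u 0 i * u 0 i by rewrite -expr2 sqr_ge0.
by apply/eqP; rewrite -sqrf_eq0 expr2 (psumr_eq0P h0 h).
Qed.

Lemma dot_gt0 u : u != 0 -> 0 < dot u u.
Proof. by move=> u0; rewrite lt_def dot_eq0 u0 dot_ge0. Qed.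

Definition dotE2 := (dotDl, dotDr, dotNl, dotNr, dotZl, dotZr).

Lemma cartanDl u v a : cartan (u + v) a = cartan u a + cartan v a.
Proof. by rewrite /cartan dotDl mulrDr mulrDl. Qed.

Lemma cartanZl c u a : cartan (c *: u) a = c * cartan u a.
Proof. by rewrite /cartan dotZl; ring. Qed.

Lemma cartan_dot u a : a != 0 -> cartan u a * dot a a = 2 * dot u a.
Proof. by move=> a0; rewrite /cartan divfK // dot_eq0. Qed.

Lemma cartan_id a : a != 0 -> cartan a a = 2.
Proof. by move=> a0; rewrite /cartan mulfK // dot_eq0. Qed.

Lemma cartan_gt0 u a : a != 0 -> (0 < cartan u a) = (0 < dot u a).
Proof. by move=> a0; rewrite /cartan pmulr_lgt0 ?invr_gt0 ?dot_gt0 // pmulr_rgt0. Qed.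

Lemma cartan_lt0 u a : a != 0 -> (cartan u a < 0) = (dot u a < 0).
Proof. by move=> a0; rewrite /cartan pmulr_llt0 ?invr_gt0 ?dot_gt0 // pmulr_rlt0. Qed.

Lemma reflD a u v : refl a (u + v) = refl a u + refl a v.
Proof. by rewrite /refl cartanDl scalerDl opprD addrACA. Qed.

Lemma reflZ a c u : refl a (c *: u) = c *: refl a u.
Proof. by rewrite /refl cartanZl scalerBr scalerA. Qed.

Lemma refl_self a : a != 0 -> refl a a = - a.
Proof.
by move=> a0; rewrite /refl cartan_id // scaler_nat mulr2n opprD addrA subrr sub0r.
Qed.

Lemma refl_dot a u v : a != 0 -> dot (refl a u) (refl a v) = dot u v.
Proof.
move=> a0; have := cartan_dot u a0; have := cartan_dot v a0.
(* Each relation is multiplied by the other Cartan number, after which the goal is linear in the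
   resulting products. *)
rewrite /refl !dotE2 (dotC a v) => /(congr1 ( *%R (cartan u a))) h1.
by move=> /(congr1 ( *%R (cartan v a))) h2; lra.
Qed.

Lemma reflK a : a != 0 -> involutive (refl a).
Proof.
move=> a0 v; rewrite {2}/refl -scaleNr reflD reflZ refl_self // /refl.
by rewrite scalerN scaleNr opprK subrK.
Qed.

Lemma refl_orth a v : dot v a = 0 -> refl a v = v.
Proof. by move=> h; rewrite /refl /cartan h mulr0 mul0r scale0r subr0. Qed.

(** * Words of reflections acting on vectors *)

Implicit Type s : seq 'rV[R]_n.

Lemma actw_cons a s v : actw (a :: s) v = refl a (actw s v).
Proof. by []. Qed.

Lemma actwD s u v : actw s (u + v) = actw s u + actw s v.
Proof. by elim: s => // a s IH; rewrite !actw_cons IH reflD. Qed.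

Lemma actwZ s c v : actw s (c *: v) = c *: actw s v.
Proof. by elim: s => // a s IH; rewrite !actw_cons IH reflZ. Qed.

Lemma actwN s v : actw s (- v) = - actw s v.
Proof. by rewrite -scaleN1r actwZ scaleN1r. Qed.

Lemma actwB s u v : actw s (u - v) = actw s u - actw s v.
Proof. by rewrite actwD actwN. Qed.

Lemma actw0 s : actw s 0 = 0.
Proof. by rewrite -(scale0r 0) actwZ !scale0r. Qed.

Lemma actw_sum s (I : finType) (P : pred I) (F : I -> 'rV[R]_n) :
  actw s (\sum_(i | P i) F i) = \sum_(i | P i) actw s (F i).
Proof.
elim/big_rec2: _ => [|i x y _ <-]; first by rewrite actw0.
by rewrite actwD.
Qed.

Lemma actw_cat s t v : actw (s ++ t) v = actw s (actw t v).
Proof. by rewrite /actw foldr_cat. Qed.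

Lemma actw_rcons s a v : actw (rcons s a) v = actw s (refl a v).
Proof. by rewrite -cats1 actw_cat. Qed.

Lemma actw_dot s u v : 0 \notin s -> dot (actw s u) (actw s v) = dot u v.
Proof.
elim: s => // a s IH; rewrite inE negb_or eq_sym => /andP[a0 s0].
by rewrite !actw_cons refl_dot // IH.
Qed.

Lemma actw_revK s : 0 \notin s -> cancel (actw s) (actw (rev s)).
Proof.
elim: s => // a s IH; rewrite inE negb_or eq_sym => /andP[a0 s0] v.
by rewrite rev_cons actw_rcons actw_cons reflK // IH.
Qed.

Lemma actwK s : 0 \notin s -> cancel (actw (rev s)) (actw s).
Proof.
by move=> s0; rewrite -{2}(revK s); apply: actw_revK; rewrite mem_rev.
Qed.

Lemma actw_refl s a v : 0 \notin s ->
  actw s (refl a v) = refl (actw s a) (actw s v).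
Proof.
by move=> s0; rewrite {2}/refl /cartan !actw_dot // -actwZ -actwB.
Qed.

End Euclid.

(** * Roots and bases *)

Section Roots.
Context {R : realFieldType} {n : nat} {D : seq 'rV[R]_n}.
Hypothesis hD : reduced_root_system D.
Implicit Types a b g : 'rV[R]_n.

Lemma root_neq0 a : a \in D -> a != 0.
Proof. by case: hD => -[_ h0 _] _ aD; apply: contraNneq h0 => <-. Qed.

Lemma root_refl a b : a \in D -> b \in D -> refl a b \in D.
Proof. by case: hD => _ [h _ _]; apply: h. Qed.

Lemma cartan_int a b : a \in D -> b \in D -> isint (cartan b a).
Proof. by case: hD => _ [_ h _]; apply: h. Qed.

Lemma root_opp a : a \in D -> - a \in D.
Proof. by move=> aD; rewrite -refl_self ?root_neq0 // root_refl. Qed.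

Lemma root_oppE a : (- a \in D) = (a \in D).
Proof. by apply/idP/idP => /root_opp; rewrite ?opprK. Qed.

(** If one of the two Cartan integers is 1, a reflection yields the difference up to sign; if both
    were at least 2, the square of [a - b] would be at most 0. *)
Lemma root_sub a b : a \in D -> b \in D -> a != b -> 0 < dot a b -> a - b \in D.
Proof.
move=> aD bD ab h; have a0 := root_neq0 aD; have b0 := root_neq0 bD.
have ca := cartan_int bD aD; have cb := cartan_int aD bD.
have ha := cartan_gt0 a b0; have hb := cartan_gt0 b a0.
rewrite h in ha; rewrite (dotC b) h in hb.
case: (eqVneq (cartan a b) 1) => [e|/(isint_ge2 ca ha) ge_a].
  by have := root_refl bD aD; rewrite /refl e scale1r.
case: (eqVneq (cartan b a) 1) => [e|/(isint_ge2 cb hb) ge_b].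
  by have := root_opp (root_refl aD bD); rewrite /refl e scale1r opprB.
have : 0 < dot (a - b) (a - b) by rewrite dot_gt0 // subr_eq0.
have := cartan_dot a b0; have := cartan_dot b a0.
rewrite !dotE2 (dotC b a).
have := dot_gt0 a0; have := dot_gt0 b0; nra.
Qed.

Lemma root_add a b : a \in D -> b \in D -> a != - b -> dot a b < 0 -> a + b \in D.
Proof.
move=> aD bD ab h; rewrite -[b]opprK; apply: root_sub => //; first exact: root_opp.
by rewrite dotNr oppr_gt0.
Qed.

Lemma actw_root (s : seq 'rV[R]_n) b : {subset s <= D} -> b \in D -> actw s b \in D.
Proof.
move=> + bD; elim: s => // a s IH hs; rewrite actw_cons; apply: root_refl.
  by apply: hs; rewrite mem_head.
by apply: IH => x xs; apply: hs; rewrite inE xs orbT.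
Qed.

Lemma subset_notin0 (s : seq 'rV[R]_n) : {subset s <= D} -> 0 \notin s.
Proof. by move=> hs; apply/negP => /hs /root_neq0; rewrite eqxx. Qed.

End Roots.

(** * Coordinates in a base and positivity *)

Section Base.
Context {R : realFieldType} {n : nat} {D Pi : seq 'rV[R]_n}.
Hypothesis hD : reduced_root_system D.
Hypothesis hB : is_base D Pi.

Implicit Types (a b g u v : 'rV[R]_n) (i j k : 'I_(size Pi)).
Local Notation p i := (Pi`_(nat_of_ord i)).
Local Notation pos := (posroot D Pi).

(** [pinvmx] gives coordinates that are linear and defined on all vectors; [rows_of Pi] is square
    only up to a proof that [size Pi] equals [n]. *)
Definition scoef (v : 'rV[R]_n) (i : 'I_(size Pi)) : R :=
  (v *m pinvmx (rows_of Pi)) 0 i.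
Local Notation co := scoef.

Lemma scoefD u v i : co (u + v) i = co u i + co v i.
Proof. by rewrite /scoef mulmxDl mxE. Qed.

Lemma scoefZ c v i : co (c *: v) i = c * co v i.
Proof. by rewrite /scoef -scalemxAl mxE. Qed.

Lemma scoefN v i : co (- v) i = - co v i.
Proof. by rewrite -scaleN1r scoefZ mulN1r. Qed.

Lemma scoefB u v i : co (u - v) i = co u i - co v i.
Proof. by rewrite scoefD scoefN. Qed.

Lemma scoef0 i : co 0 i = 0.
Proof. by rewrite -(scale0r 0) scoefZ mul0r. Qed.

Lemma comb_rows (c : 'I_(size Pi) -> R) :
  \sum_i c i *: p i = (\row_i c i) *m rows_of Pi.
Proof.
by rewrite mulmx_sum_row; apply: eq_bigr => i _; rewrite mxE rowK.
Qed.

Lemma coef_comb (c : 'I_(size Pi) -> R) i : co (\sum_j c j *: p j) i = c i.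
Proof. by case: hB => _ _ fr _; rewrite /scoef comb_rows mulmxKp // mxE. Qed.

Lemma simple_root i : p i \in D.
Proof. by case: hB => _ h _ _; apply: h; rewrite mem_nth. Qed.

Lemma simple_neq0 i : p i != 0.
Proof. exact: (root_neq0 hD (simple_root i)). Qed.

Lemma root_comb b : b \in D -> b = \sum_i co b i *: p i.
Proof.
move=> bD; case: hB => _ _ _ /(_ b bD) [c [eb _]].
rewrite {1}eb; apply: eq_bigr => i _; congr (_ *: _).
by rewrite {1}eb (coef_comb (fun i => (c i)%:~R)).
Qed.

(** The roots span the space and are combinations of simple roots, so the simple roots span it
    too. *)
Lemma vec_comb v : v = \sum_i co v i *: p i.
Proof.
have full : row_full (rows_of Pi).
  case: hD => -[_ _]; rewrite -!sub1mx => fD _.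
  apply: (submx_trans fD); apply/row_subP => i; rewrite rowK.
  by rewrite (root_comb (mem_nth 0 (ltn_ord i))) comb_rows submxMl.
rewrite (comb_rows (co v)) -[LHS](mulmxKpV (submx_full v full)).
by congr (_ *m _); apply/rowP => i; rewrite [RHS]mxE.
Qed.

Lemma coef_inj u v : (forall i, co u i = co v i) -> u = v.
Proof. by move=> h; rewrite (vec_comb u) (vec_comb v); under eq_bigr do rewrite h. Qed.

Lemma coef_simple i j : co (p i) j = (i == j)%:R.
Proof.
have -> : p i = \sum_k (i == k)%:R *: p k.
  rewrite (bigD1 i) //= eqxx scale1r big1 ?addr0 // => k ki.
  by rewrite eq_sym (negbTE ki) scale0r.
by rewrite (coef_comb (fun k => (i == k)%:R)).
Qed.

Lemma simple_inj i j : p i = p j -> i = j.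
Proof.
move=> h; have := coef_simple i j; rewrite h coef_simple eqxx.
by case: eqP => // _ /eqP; rewrite oner_eq0.
Qed.

Lemma coef_int b i : b \in D -> isint (co b i).
Proof.
move=> bD; case: hB => _ _ _ /(_ b bD) [c [-> _]].
by rewrite (coef_comb (fun i => (c i)%:~R)); exists (c i).
Qed.

Lemma posP g : pos g <-> g \in D /\ forall i, 0 <= co g i.
Proof.
split=> [[gD [c eg]]|[gD h]]; split=> //.
  by move=> i; rewrite eg (coef_comb (fun i => (c i)%:R)).
have [c hc] := fin_all_exists (fun i => isint_natP (coef_int i gD) (h i)).
by exists c; rewrite {1}(root_comb gD); apply: eq_bigr => i _; rewrite hc.
Qed.

(** The order [rle] without its integrality condition; the two agree on roots by [rle_cle] and
    [cle_rle]. *)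
Definition cle (u v : 'rV[R]_n) := forall i, co u i <= co v i.

Lemma cle_refl u : cle u u. Proof. by move=> i. Qed.

Lemma cle_trans u v w : cle u v -> cle v w -> cle u w.
Proof. by move=> h1 h2 i; apply: le_trans (h1 i) (h2 i). Qed.

Lemma cle_anti u v : cle u v -> cle v u -> u = v.
Proof. by move=> h1 h2; apply: coef_inj => i; apply/eqP; rewrite eq_le h1 h2. Qed.

Lemma rle_cle u v : rle Pi u v -> cle u v.
Proof.
case=> c h i; rewrite -subr_ge0 -scoefB h.
by rewrite (coef_comb (fun i => (c i)%:R)).
Qed.

Lemma cle_rle u v : u \in D -> v \in D -> cle u v -> rle Pi u v.
Proof.
move=> uD vD h.
have hi i : exists k : nat, co (v - u) i = k%:R.
  apply: isint_natP; rewrite scoefB; last by rewrite subr_ge0.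
  by apply: isintB; apply: coef_int.
have [c hc] := fin_all_exists hi.
by exists c; rewrite {1}(vec_comb (v - u)); apply: eq_bigr => i _; rewrite hc.
Qed.

Lemma root_sign b : b \in D -> pos b \/ pos (- b).
Proof.
move=> bD; case: hB => _ _ _ /(_ b bD) [c [eb]].
have hc i : co b i = (c i)%:~R by rewrite eb (coef_comb (fun i => (c i)%:~R)).
case=> hs; [left|right]; apply/posP; split=> [|i]; rewrite ?hc ?ler0z ?(root_opp hD) //.
by rewrite scoefN hc oppr_ge0 lerz0.
Qed.

Lemma pos_root g : pos g -> g \in D. Proof. by case. Qed.

Lemma pos_coef_ge0 g i : pos g -> 0 <= co g i.
Proof. by case/posP. Qed.

Lemma pos_of_coef b i : b \in D -> 0 < co b i -> pos b.
Proof.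
move=> bD h; case: (root_sign bD) => // /posP[_ /(_ i)].
by rewrite scoefN oppr_ge0 leNgt h.
Qed.

Lemma pos_neq0 g : pos g -> g != 0.
Proof. by move/pos_root/(root_neq0 hD). Qed.

Lemma pos_coef_gt0 g : pos g -> exists i, 0 < co g i.
Proof.
move=> pg; apply/existsP; apply: contraT => /existsPn h.
case/eqP: (pos_neq0 pg); apply: coef_inj => i; rewrite scoef0.
by apply/eqP; rewrite eq_le pos_coef_ge0 // andbT leNgt.
Qed.

Lemma pos_asym g : pos g -> ~ pos (- g).
Proof.
move=> pg; have [i hi] := pos_coef_gt0 pg => /posP[_ /(_ i)].
by rewrite scoefN oppr_ge0 leNgt hi.
Qed.

Lemma pos_simple i : pos (p i).
Proof. by apply/posP; split=> [|j]; rewrite ?simple_root // coef_simple ler0n. Qed.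

Lemma pos_up g b : pos g -> b \in D -> cle g b -> pos b.
Proof.
by move=> /posP[_ h] bD gb; apply/posP; split=> // i; apply: le_trans (h i) (gb i).
Qed.

Lemma pos_sum_neq g b : pos g -> pos b -> g + b != 0.
Proof.
by move=> pg pb; rewrite addr_eq0; apply/eqP => e; case: (pos_asym pb); rewrite -e.
Qed.

Lemma simple_obtuse i j : i != j -> dot (p i) (p j) <= 0.
Proof.
move=> ij; rewrite leNgt; apply/negP => h.
have pij : p i != p j by apply: contraNneq ij => /simple_inj ->.
have hs := root_sub hD (simple_root i) (simple_root j) pij h.
case: (root_sign hs) => /posP[_ hc].
  have := hc j; rewrite scoefB !coef_simple eqxx (negbTE ij) /=; lra.
have := hc i; rewrite scoefN scoefB !coef_simple eqxx eq_sym (negbTE ij) /=; lra.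
Qed.

Lemma coef_refl i v j : co (refl (p i) v) j = co v j - cartan v (p i) * (i == j)%:R.
Proof. by rewrite /refl scoefB scoefZ coef_simple. Qed.

(** Otherwise [g] is a multiple of [p i], and reducedness makes it [p i] or its opposite. *)
Lemma pos_other g i : pos g -> g != p i -> exists2 j, j != i & 0 < co g j.
Proof.
move=> pg gi; apply/exists_inP; apply: contraT => /exists_inPn h.
have e : g = co g i *: p i.
  rewrite {1}(vec_comb g) (bigD1 i) //= big1 ?addr0 // => j ji.
  have := h j ji; rewrite -leNgt => le0.
  have /eqP -> : co g j == 0 by rewrite eq_le le0 pos_coef_ge0.
  by rewrite scale0r.
case: hD => _ [_ _ hred]; have gD := pos_root pg.
have := hred (p i) (co g i) (simple_root i); rewrite -e => /(_ gD) [] e1.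
  by case/eqP: gi; rewrite e e1 scale1r.
by have := pos_coef_ge0 i pg; rewrite e1; lra.
Qed.

(** Only coordinate [i] changes, and [pos_other] provides a positive one elsewhere. *)
Lemma refl_pos g i : pos g -> g != p i -> pos (refl (p i) g).
Proof.
move=> pg gi; have [j ji hj] := pos_other pg gi.
apply: (@pos_of_coef _ j); first exact: (root_refl hD (simple_root i) (pos_root pg)).
by rewrite coef_refl eq_sym (negbTE ji) mulr0 subr0.
Qed.

Lemma dot_comb u v : dot u v = \sum_i co u i * dot (p i) v.
Proof. by rewrite {1}(vec_comb u) dot_suml; apply: eq_bigr => i _; rewrite dotZl. Qed.

Lemma cartan_comb u v : cartan u v = \sum_i co u i * cartan (p i) v.
Proof.
rewrite /cartan dot_comb mulr_sumr mulr_suml; apply: eq_bigr => i _; ring.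
Qed.

Lemma dot_gt0_simple u v : (forall i, 0 <= co u i) -> 0 < dot u v ->
  exists2 i, 0 < co u i & 0 < dot (p i) v.
Proof.
move=> hu h; apply/exists_inP; apply: contraT => /exists_inPn hn.
move: h; rewrite ltNge dot_comb => /negP[]; apply: sumr_le0 => i _.
have := hu i; rewrite le_eqVlt => /predU1P[<-|ci]; first by rewrite mul0r.
by rewrite pmulr_rle0 // leNgt; apply: hn.
Qed.

(** * Height and induction on positive roots *)

Definition ht v := \sum_i co v i.

Lemma htD u v : ht (u + v) = ht u + ht v.
Proof. by rewrite /ht -big_split; apply: eq_bigr => i _; rewrite scoefD. Qed.

Lemma htN v : ht (- v) = - ht v.
Proof. by rewrite /ht -sumrN; apply: eq_bigr => i _; rewrite scoefN. Qed.

Lemma htZ c v : ht (c *: v) = c * ht v.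
Proof. by rewrite /ht mulr_sumr; apply: eq_bigr => i _; rewrite scoefZ. Qed.

Lemma ht_simple i : ht (p i) = 1.
Proof.
rewrite /ht (bigD1 i) //= coef_simple eqxx big1 ?addr0 // => j ji.
by rewrite coef_simple eq_sym (negbTE ji).
Qed.

Lemma ht_int b : b \in D -> isint (ht b).
Proof. by move=> bD; apply: isint_sum => i; apply: coef_int. Qed.

Lemma ht_pos_gt0 g : pos g -> 0 < ht g.
Proof.
move=> pg; have [i hi] := pos_coef_gt0 pg.
rewrite /ht (bigD1 i) //= ltr_pwDl // sumr_ge0 // => j _; exact: pos_coef_ge0.
Qed.

Lemma simple_not_sum i g b : pos g -> pos b -> p i = g + b -> False.
Proof.
move=> pg pb e; have := ht_simple i; rewrite e htD.
have := isint_ge1 (ht_int (pos_root pg)) (ht_pos_gt0 pg).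
by have := isint_ge1 (ht_int (pos_root pb)) (ht_pos_gt0 pb); lra.
Qed.

Lemma cle_ht u v : cle u v -> ht u <= ht v.
Proof. by move=> h; apply: ler_sum => i _. Qed.

(** Induction on height: as [g] has positive square, some simple root has positive product with it,
    and reflecting in that root lowers the height. *)
Lemma pos_ind (P : 'rV[R]_n -> Prop) :
  (forall i, P (p i)) ->
  (forall g i, pos g -> g != p i -> P g -> P (refl (p i) g)) ->
  forall g, pos g -> P g.
Proof.
move=> hs hr g pg; have [N hN] := isint_bound (ht_int (pos_root pg)).
elim: N g pg hN => [|N IH] g pg hN; first by have := ht_pos_gt0 pg; lra.
have gD := pos_root pg; have [i _ hi] : exists2 i, 0 < co g i & 0 < dot (p i) g.
  by apply: dot_gt0_simple; [case/posP: pg | apply/dot_gt0/pos_neq0].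
case: (eqVneq g (p i)) => [->|gi]; first exact: hs.
have ci : 1 <= cartan g (p i).
  apply: isint_ge1; first exact: (cartan_int hD (simple_root i) gD).
  by rewrite cartan_gt0 ?simple_neq0 // dotC.
have pr := refl_pos pg gi.
rewrite -(reflK (simple_neq0 i) g); apply: hr => //.
  apply/eqP => e; apply: (pos_asym (pos_simple i)).
  by rewrite -refl_self ?simple_neq0 // -{2}e reflK ?simple_neq0.
apply: IH => //; rewrite /refl htD htN htZ ht_simple mulr1.
by move: hN; rewrite -natr1; lra.
Qed.

End Base.

(** * Supports of positive roots and the Dynkin diagram *)

Section Diagram.
Context {R : realFieldType} {n : nat} {D Pi : seq 'rV[R]_n}.
Hypothesis hD : reduced_root_system D.
Hypothesis hB : is_base D Pi.

Implicit Types (a b g u v x y z : 'rV[R]_n) (i j k : 'I_(size Pi)).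
Local Notation p i := (Pi`_(nat_of_ord i)).
Local Notation pos := (posroot D Pi).
Local Notation co := (@scoef R n Pi).
Local Notation cle := (@cle R n Pi).
Local Notation ht := (@ht R n Pi).

(* These numbers are the coordinates of the coroot of [g] on the simple coroots. *)
Lemma coroot_int g i : pos g -> isint (co g i * dot (p i) (p i) / dot g g).
Proof.
move=> pg; elim/(pos_ind hD hB): g / pg => [k|g k pg _ IH].
  rewrite (coef_simple hB); case: eqP => [->|_].
    by rewrite mul1r divff ?dot_eq0 ?(simple_neq0 hD hB) //; apply: isint1.
  by rewrite !mul0r; apply: isint0.
rewrite (coef_refl hB) refl_dot ?(simple_neq0 hD hB) //.
case: eqP => [->|_]; last by rewrite mulr0 subr0.
have e := cartan_dot g (simple_neq0 hD hB i).
suff -> : (co g i - cartan g (p i) * true%:R) * dot (p i) (p i) / dot g g =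
   co g i * dot (p i) (p i) / dot g g - cartan (p i) g.
  by apply: isintB => //; apply: (cartan_int hD (pos_root pg)); apply: simple_root.
by rewrite mulr1 mulrBl e mulrBl /cartan (dotC g).
Qed.

(** The coroot coordinate of [coroot_int] is here a positive integer, hence at least 1. *)
Lemma coroot_ge g i : pos g -> 0 < co g i -> dot g g <= co g i * dot (p i) (p i).
Proof.
move=> pg hi; have g0 := dot_gt0 (pos_neq0 hD pg).
have := isint_ge1 (coroot_int i pg); rewrite ler_pdivlMr // mul1r; apply.
by rewrite divr_gt0 // mulr_gt0 // dot_gt0 // (simple_neq0 hD hB).
Qed.

Lemma simple_adj i j : i != j -> dot (p i) (p j) != 0 ->
  2 * dot (p i) (p j) <= - dot (p i) (p i).
Proof.
move=> ij d0; have i0 := simple_neq0 hD hB i.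
have lt0 : dot (p j) (p i) < 0 by rewrite dotC lt_neqAle d0 (simple_obtuse hD hB).
have := isintN (cartan_int hD (simple_root hB i) (simple_root hB j)).
move/isint_ge1; rewrite oppr_gt0 cartan_lt0 // => /(_ lt0).
have := cartan_dot (p j) i0; rewrite (dotC (p i) (p j)); have := dot_gt0 i0; nra.
Qed.

Lemma dot_new_le0 g k : (forall i, 0 <= co g i) -> co g k = 0 -> dot g (p k) <= 0.
Proof.
move=> hg gk; rewrite (dot_comb hD hB); apply: sumr_le0 => i _.
case: (eqVneq i k) => [->|ik]; first by rewrite gk mul0r.
by rewrite mulr_ge0_le0 // (simple_obtuse hD hB).
Qed.

Lemma dot_new_lt0 g j k : (forall i, 0 <= co g i) -> co g k = 0 -> 0 < co g j ->
  dot (p j) (p k) != 0 -> dot g (p k) < 0.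
Proof.
move=> hg gk gj d0; have jk : j != k by apply: contraTneq gj => ->; rewrite gk ltxx.
have lt0 : dot (p j) (p k) < 0 by rewrite lt_neqAle d0 (simple_obtuse hD hB).
rewrite (dot_comb hD hB) (bigD1 j) //= ltr_nwDl ?pmulr_rlt0 //.
apply: sumr_le0 => i _; case: (eqVneq i k) => [->|ik]; first by rewrite gk mul0r.
by rewrite mulr_ge0_le0 // (simple_obtuse hD hB).
Qed.

Lemma pos_add_new g j k : pos g -> co g k = 0 -> 0 < co g j ->
  dot (p j) (p k) != 0 -> g + p k \in D.
Proof.
move=> pg gk gj d0; apply: (root_add hD); rewrite ?(pos_root pg) ?(simple_root hB) //.
  by rewrite -addr_eq0; apply: (pos_sum_neq hD hB) => //; apply: pos_simple.
by apply: dot_new_lt0 gj d0 => [i|] //; apply: (pos_coef_ge0 hB).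
Qed.

(** Were [g] orthogonal to [p k], reflecting [g + p k] would give the root [g - p k], whose
    coordinates have both signs. *)
Lemma new_neighbor g k : pos g -> co g k = 0 -> g + p k \in D ->
  exists2 j, 0 < co g j & dot (p j) (p k) != 0.
Proof.
move=> pg gk gD; have k0 := simple_neq0 hD hB k.
have le0 : dot g (p k) <= 0 by apply: dot_new_le0 => // i; apply: (pos_coef_ge0 hB).
have lt0 : dot g (p k) < 0.
  rewrite lt_neqAle le0 andbT; apply/eqP => d0.
  have := root_refl hD (simple_root hB k) gD.
  rewrite reflD refl_self // refl_orth // => hs.
  have [j gj] := pos_coef_gt0 hD hB pg.
  have jk : j != k by apply: contraTneq gj => ->; rewrite gk ltxx.
  have ps : pos (g - p k).
    apply: (pos_of_coef hD hB (i := j)) => //.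
    by rewrite scoefB (coef_simple hB) eq_sym (negbTE jk) subr0.
  have := pos_coef_ge0 hB k ps; rewrite scoefB (coef_simple hB) eqxx gk /=; lra.
have [||j gj dj] := dot_gt0_simple hD hB (u := g) (v := - p k).
- by move=> i; apply: (pos_coef_ge0 hB).
- by rewrite dotNr oppr_gt0.
- by exists j => //; move: dj; rewrite dotNr oppr_gt0 => /ltr0_neq0.
Qed.

(* The Dynkin diagram is a tree: otherwise a root [g] meeting a cycle through
   [p i] would satisfy [|g + p i|^2 <= 0]. *)
Lemma one_neighbor g i j k : pos g -> co g i = 0 -> 0 < co g j -> 0 < co g k ->
  dot (p j) (p i) != 0 -> dot (p k) (p i) != 0 -> j = k.
Proof.
move=> pg gi gj gk dj dk; apply/eqP; apply: contraT => jk.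
have ji : j != i by apply: contraTneq gj => ->; rewrite gi ltxx.
have ki : k != i by apply: contraTneq gk => ->; rewrite gi ltxx.
have ge0 l : 0 <= co g l := pos_coef_ge0 hB l pg.
(* The edge from [p j] cancels the square of [g], the edge from [p k] that of [p i]. *)
have hj : 2 * (co g j * dot (p j) (p i)) <= - dot g g.
  have := simple_adj ji dj; have := coroot_ge pg gj; nra.
have hk : 2 * (co g k * dot (p k) (p i)) <= - dot (p i) (p i).
  have ik : i != k by rewrite eq_sym.
  have dk' : dot (p i) (p k) != 0 by rewrite dotC.
  have := simple_adj ik dk'; rewrite (dotC (p i) (p k)).
  have := isint_ge1 (coef_int hB k (pos_root pg)) gk.
  have := dot_ge0 (p i); nra.
have hs : dot g (p i) <= co g j * dot (p j) (p i) + co g k * dot (p k) (p i).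
  rewrite (dot_comb hD hB) (bigD1 j) //= (bigD1 k) 1?eq_sym //= addrA gerDl.
  apply: sumr_le0 => l _; case: (eqVneq l i) => [->|li]; first by rewrite gi mul0r.
  by rewrite mulr_ge0_le0 // (simple_obtuse hD hB).
have : 0 < dot (g + p i) (g + p i).
  by apply/dot_gt0/(pos_sum_neq hD hB) => //; apply: pos_simple.
rewrite !dotE2 (dotC (p i) g); lra.
Qed.

(** Comparable positive roots are joined by a chain of roots, each step adding a simple root. Some
    [p i] occurring in [y - x] has positive product with it, so [x + p i] or [y - p i] is a root
    between them. *)
Lemma chain_ind (P : 'rV[R]_n -> Prop) x y : pos x -> pos y -> cle x y -> P x ->
  (forall g i, pos g -> cle x g -> g + p i \in D -> cle (g + p i) y ->
     P g -> P (g + p i)) ->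
  P y.
Proof.
move=> px py; have [N] : exists N : nat, ht y - ht x <= N%:R.
  by apply: isint_bound; apply: isintB; apply: (ht_int hB); apply: (pos_root (Pi := Pi)).
elim: N x y px py => [|N IH] x y px py hN xy Px step.
  suff -> : y = x by [].
  apply: (coef_inj hD hB) => i; apply/eqP; rewrite eq_le xy andbT leNgt; apply/negP => hi.
  have : ht x < ht y.
    rewrite /ht (bigD1 i) //= [ltRHS](bigD1 i) //= ltr_leD //.
    by apply: ler_sum => j _; apply: xy.
  by rewrite -subr_gt0 ltNge hN.
case: (eqVneq x y) => [<-//|xny].
have hge i : 0 <= co (y - x) i by rewrite scoefB subr_ge0.
have [|i ci di] := dot_gt0_simple hD hB (u := y - x) (v := y - x) hge.
  by apply: dot_gt0; rewrite subr_eq0 eq_sym.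
have ci1 : 1 <= co y i - co x i.
  apply: isint_ge1; last by rewrite -scoefB.
  by apply: isintB; apply: (coef_int hB); apply: (pos_root (Pi := Pi)).
have pi := pos_simple hB i; have iD := simple_root hB i.
have hx : cle x (x + p i) by move=> j; rewrite scoefD lerDl (pos_coef_ge0 hB).
have hy : cle (y - p i) y by move=> j; rewrite scoefB gerBl (pos_coef_ge0 hB).
have hxy j : co x j + co (p i) j <= co y j.
  rewrite (coef_simple hB); case: eqP => [<-|_]; first by move: ci1; rewrite /=; lra.
  by rewrite addr0; apply: xy.
case: (ltrP (dot (p i) x) 0) => dx.
  have xD : x + p i \in D.
    apply: (root_add hD) => //; rewrite ?(pos_root px) //.
      by rewrite -addr_eq0 (pos_sum_neq hD hB).
    by rewrite dotC.
  have xiy : cle (x + p i) y by move=> j; rewrite scoefD.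
  apply: (IH (x + p i) y) => //.
  - exact: (pos_up hB px).
  - by move: hN; rewrite htD (ht_simple hB) -natr1; lra.
  - exact: step.
  - by move=> g j pg xg; apply: step => //; apply: cle_trans xg.
have yni : y != p i.
  apply/eqP => yi; have /cle_ht : cle (x + p i) y by move=> l; rewrite scoefD; apply: hxy.
  by rewrite yi htD (ht_simple hB); have := ht_pos_gt0 hD hB px; lra.
have yD : y - p i \in D.
  apply: (root_sub hD) => //; first exact: (pos_root py).
  by move: di; rewrite dotBr dotC; lra.
have xyi : cle x (y - p i) by move=> j; rewrite scoefB lerBrDr.
have pyi := pos_up hB px yD xyi.
rewrite -(subrK (p i) y); apply: (step) => //; rewrite ?subrK //.
  exact: (pos_root py).
apply: (IH x) => //.
  by move: hN; rewrite htD htN (ht_simple hB) -natr1; lra.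
move=> g j pg xg gD gy; apply: step => //; exact: cle_trans gy hy.
Qed.

Lemma chain_step x y : pos x -> pos y -> cle x y -> x != y ->
  exists i, x + p i \in D /\ cle (x + p i) y.
Proof.
move=> px py xy; suff : y = x \/ exists i, x + p i \in D /\ cle (x + p i) y.
  by case=> // ->; rewrite eqxx.
(* Only the first [y] moves along the chain; the one in the upper bound stays fixed. *)
pattern y at 1; apply: (chain_ind px py xy); first by left.
by move=> g i pg xg gD gy [e|]; [right; exists i; rewrite -e | right].
Qed.

(** Along the chain from [x] to [z], each simple root that is new is adjacent to the support already
    reached, so it can be added to [r'] as well. *)
Lemma support_union x z r : pos x -> pos z -> cle x z -> pos r ->
  (forall i, 0 < co x i -> 0 < co r i) ->
  exists2 r', pos r' & forall i, (0 < co r' i) = (0 < co r i) || (0 < co z i).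
Proof.
move=> px pz xz pr xr; pattern z; apply: (chain_ind px pz xz).
  exists r => // i; apply/idP/orP => [->|[]//]; [by left | exact: xr].
move=> g i pg xg gD _ [r' pr' hr'].
have gi_supp l : (0 < co (g + p i) l) = (0 < co g l) || (i == l).
  rewrite scoefD (coef_simple hB); have := pos_coef_ge0 hB l pg.
  by case: eqP => _ h; rewrite ?orbT ?orbF ?addr0 //= ltr_wpDl.
case: (ltrP 0 (co r' i)) => hi.
  exists r' => // l; rewrite gi_supp hr'; case: eqP => [<-|_]; rewrite ?orbF //.
  by rewrite !orbT -hr' hi.
have r'i : co r' i = 0 by apply/eqP; rewrite eq_le hi (pos_coef_ge0 hB).
have gi : co g i = 0.
  apply/eqP; rewrite eq_le (pos_coef_ge0 hB) // andbT leNgt; apply/negP => h.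
  by move: hi; rewrite leNgt hr' h orbT.
have [j gj dj] := new_neighbor pg gi gD.
have r'D : r' + p i \in D.
  by apply: (pos_add_new (j := j)) => //; rewrite hr' gj orbT.
exists (r' + p i).
  apply: (pos_up hB pr' r'D) => l; rewrite scoefD lerDl (pos_coef_ge0 hB) //.
  exact: pos_simple.
move=> l; rewrite gi_supp orbA -hr' scoefD (coef_simple hB).
have := pos_coef_ge0 hB l pr'.
by case: eqP => _ h; rewrite ?orbT ?orbF ?addr0 //= ltr_wpDl.
Qed.

(** [x'] is the last root before [p i] first occurs in the chain from [x] to [y]. *)
Lemma chain_enter x y i : pos x -> pos y -> cle x y -> co x i = 0 -> 0 < co y i ->
  exists x', [/\ pos x', cle x x', co x' i = 0, x' + p i \in D & cle (x' + p i) y].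
Proof.
move=> px py xy xi; suff : co y i = 0 \/
  exists x', [/\ pos x', cle x x', co x' i = 0, x' + p i \in D & cle (x' + p i) y].
  by case=> // ->; rewrite ltxx.
pattern y; apply: (chain_ind px py xy); first by left.
move=> g j pg xg gD gy [gi|[x' [h1 h2 h3 h4 h5]]]; last first.
  right; exists x'; split=> //; apply: (cle_trans h5) => l.
  by rewrite scoefD lerDl (pos_coef_ge0 hB) //; apply: pos_simple.
case: (eqVneq j i) => [ji|ji].
  by subst j; right; exists g; split=> // l.
by left; rewrite scoefD gi (coef_simple hB) (negbTE ji) addr0.
Qed.

(* Both [y1] and [y2] are reached from [x] along the unique path of the
   diagram joining the support of [x] to [p i]. *)
Lemma roots_meet x y1 y2 i : pos x -> pos y1 -> pos y2 -> cle x y1 -> cle x y2 ->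
  co x i = 0 -> 0 < co y1 i -> 0 < co y2 i ->
  exists y, [/\ pos y, cle x y, cle y y1, cle y y2 & 0 < co y i].
Proof.
move=> px py1; have [N] := isint_bound (ht_int hB (pos_root py1)).
(* Induction on the height of [y1]; [i] varies because the recursive call is made at its neighbour
   [j]. *)
elim: N i y1 y2 py1 => [|N IH] i y1 y2 py1 hN py2 xy1 xy2 xi y1i y2i.
  by have := ht_pos_gt0 hD hB py1; lra.
have [x1 [px1 xx1 x1i x1D x1y]] := chain_enter px py1 xy1 xi y1i.
have [x2 [px2 xx2 x2i x2D x2y]] := chain_enter px py2 xy2 xi y2i.
have [j1 x1j dj1] := new_neighbor px1 x1i x1D.
have [j2 x2j dj2] := new_neighbor px2 x2i x2D.
(* Both neighbours of [p i] lie in the support of the single root [r], so [one_neighbor] identifies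
   them. *)
have [r pr hr] : exists2 r, pos r &
    forall l, (0 < co r l) = (0 < co x1 l) || (0 < co x2 l).
  by apply: support_union px px2 xx2 px1 _ => l /lt_le_trans; apply.
have ri : co r i = 0.
  by apply/eqP; rewrite eq_le (pos_coef_ge0 hB) // andbT leNgt hr x1i x2i ltxx.
have e : j1 = j2.
  by apply: (one_neighbor pr ri) => //; rewrite hr ?x1j ?x2j ?orbT.
subst j2; rename j1 into j.
have [y [py xy yx1 yx2 yj]] :
    exists y, [/\ pos y, cle x y, cle y x1, cle y x2 & 0 < co y j].
  case: (ltrP 0 (co x j)) => xj; first by exists x; split=> //; apply: cle_refl.
  apply: IH => //; last by apply/eqP; rewrite eq_le xj (pos_coef_ge0 hB).
  have := cle_ht x1y; rewrite htD (ht_simple hB); move: hN; rewrite -natr1; lra.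
have yi : co y i = 0 by apply/eqP; rewrite eq_le (pos_coef_ge0 hB) // andbT -x1i.
have yD := pos_add_new py yi yj dj1.
have yyi : cle y (y + p i).
  by move=> l; rewrite scoefD lerDl (pos_coef_ge0 hB) //; apply: pos_simple.
exists (y + p i); split.
- exact: (pos_up hB py yD yyi).
- exact: cle_trans xy yyi.
- by apply: cle_trans x1y => l; rewrite !scoefD lerD2r.
- by apply: cle_trans x2y => l; rewrite !scoefD lerD2r.
- by rewrite scoefD yi add0r (coef_simple hB) eqxx.
Qed.

(** [s] cuts the diagram into two orthogonal sides. A simple reflection fixes the roots supported on
    the other side, so building roots by reflections never leaves a side. *)
Lemma support_connected (s : pred 'I_(size Pi)) g : pos g ->
  (forall i j, s i -> ~~ s j -> dot (p i) (p j) = 0) ->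
  (forall i, 0 < co g i -> s i) \/ (forall i, 0 < co g i -> ~~ s i).
Proof.
move=> pg hs; have orth (t : pred 'I_(size Pi)) u k : pos u -> ~~ t k ->
    (forall i j, t i -> ~~ t j -> dot (p i) (p j) = 0) ->
    (forall i, 0 < co u i -> t i) -> refl (p k) u = u.
  move=> pu tk ht hu; apply: refl_orth; rewrite (dot_comb hD hB) big1 // => i _.
  have := pos_coef_ge0 hB i pu; rewrite le_eqVlt => /predU1P[<-|/hu ti].
    by rewrite mul0r.
  by rewrite ht // mulr0.
have keep (t : pred 'I_(size Pi)) u k : t k -> (forall i, 0 < co u i -> t i) ->
    forall i, 0 < co (refl (p k) u) i -> t i.
  move=> tk hu i; rewrite (coef_refl hB); case: eqP => [<-//|_].
  by rewrite mulr0 subr0; apply: hu.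
elim/(pos_ind hD hB): g / pg => [k|g k pg _ [IH|IH]].
- case: (boolP (s k)) => sk; [left|right] => i; rewrite (coef_simple hB);
    by case: eqP => [<-//|_]; rewrite ltxx.
- left; case: (boolP (s k)) => sk; first exact: keep.
  by rewrite (orth s).
- right; case: (boolP (s k)) => sk; last exact: keep.
  rewrite (orth (predC s)) //= ?negbK // => i j si; rewrite negbK => sj.
  by rewrite dotC hs.
Qed.

End Diagram.

(** * The highest root and type A *)

Section HighestRoot.
Context {R : realFieldType} {n : nat} {D Pi : seq 'rV[R]_n} {th : 'rV[R]_n}.
Hypothesis hD : reduced_root_system D.
Hypothesis hB : is_base D Pi.
Hypothesis hth : highest_root D Pi th.

Implicit Types (b g u v x y z : 'rV[R]_n) (a i j k : 'I_(size Pi)).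
Local Notation p i := (Pi`_(nat_of_ord i)).
Local Notation pos := (posroot D Pi).
Local Notation co := (@scoef R n Pi).
Local Notation cle := (@cle R n Pi).

Lemma th_pos : pos th. Proof. by case: hth. Qed.

Lemma th_root : th \in D. Proof. exact: (pos_root th_pos). Qed.

Lemma th_neq0 : th != 0. Proof. exact: (pos_neq0 hD th_pos). Qed.

Lemma th_max g : pos g -> cle g th.
Proof. by case: hth => _ h /h; apply: (rle_cle hB). Qed.

Lemma th_coef_ge1 i : 1 <= co th i.
Proof. by have := th_max (pos_simple hB i) i; rewrite (coef_simple hB) eqxx. Qed.

(** Otherwise [th + p i] would be a root above [th]. *)
Lemma th_dominant i : 0 <= dot (p i) th.
Proof.
rewrite leNgt; apply/negP => h.
have ti : cle th (th + p i).
  by move=> j; rewrite scoefD lerDl (pos_coef_ge0 hB) //; apply: pos_simple.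
have tD : th + p i \in D.
  apply: (root_add hD); rewrite ?th_root ?(simple_root hB) //; last by rewrite dotC.
  by rewrite -addr_eq0 (pos_sum_neq hD hB) //; [exact: th_pos | exact: pos_simple].
have := th_max (pos_up hB th_pos tD ti) i.
by rewrite scoefD (coef_simple hB) eqxx /=; lra.
Qed.

Lemma cartan_th_ge0 g : (forall i, 0 <= co g i) -> 0 <= cartan g th.
Proof.
move=> hg; rewrite (cartan_comb hD hB); apply: sumr_ge0 => i _.
by rewrite mulr_ge0 // leNgt cartan_lt0 ?th_neq0 // -leNgt th_dominant.
Qed.

(** With a value [c] of at least 2, [c *: th - g] would be a positive root, hence below [th]; then
    [g] lies above [(c - 1) *: th] and equals [th]. *)
Lemma cartan_th_le1 g : pos g -> g != th -> cartan g th <= 1.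
Proof.
move=> pg gth; rewrite leNgt; apply/negP => h.
have c2 : 2 <= cartan g th.
  apply: isint_ge2; [|by lra|by apply/eqP; lra].
  exact: (cartan_int hD th_root (pos_root pg)).
have uD := root_opp hD (root_refl hD th_root (pos_root pg)).
have uE i : co (- refl th g) i = cartan g th * co th i - co g i.
  by rewrite /refl !(scoefN, scoefB, scoefZ) opprB.
have ge i := th_coef_ge1 i.
have [i0 _] := pos_coef_gt0 hD hB pg.
have pu : pos (- refl th g).
  apply: (pos_of_coef hD hB (i := i0)) => //; rewrite uE.
  have := th_max pg i0; have := ge i0; nra.
case/eqP: gth; apply: (cle_anti hD hB) (th_max pg) _ => i.
have := th_max pu i; rewrite uE; have := ge i; nra.
Qed.

(* [s] is a path of simple edges in the diagram along which [th] has coefficients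
   1, listed from its moving end; no vertex but the moving end has a neighbour
   outside [s], and the last clause bounds the weight of its outer neighbours. *)
Definition good_path a (s : seq 'I_(size Pi)) : Prop :=
  [/\ uniq s, {in s, forall j, co th j = 1 /\ dot (p j) (p j) = dot th th},
      (forall j k, j \in behead s -> k \notin s -> dot (p j) (p k) = 0),
      (forall q k : nat, (q < size s)%N -> (k < size s)%N -> q != k ->
         cartan (p (nth a s q)) (p (nth a s k)) * cartan (p (nth a s k)) (p (nth a s q)) =
         if (q.+1 == k) || (k.+1 == q) then 1 else 0)
    & \sum_(k | k \notin s) co th k * - cartan (p k) (p (head a s)) <= 1].

Lemma neg_cartan_ge1 i j : i != j -> dot (p i) (p j) != 0 -> 1 <= - cartan (p i) (p j).
Proof.
move=> ij d0; apply: isint_ge1.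
  by apply/isintN/(cartan_int hD); apply: (simple_root hB).
rewrite oppr_gt0 cartan_lt0 ?(simple_neq0 hD hB) //.
by rewrite lt_neqAle d0 (simple_obtuse hD hB).
Qed.

Lemma neg_cartan_ge0 i j : i != j -> 0 <= - cartan (p i) (p j).
Proof.
move=> ij; rewrite oppr_ge0 leNgt cartan_gt0 ?(simple_neq0 hD hB) //.
by rewrite -leNgt (simple_obtuse hD hB).
Qed.

(* The value of [th] on the coroot of the last vertex [b] is the number of
   neighbours of [b], weighted by the coefficients of [th]; it leaves room for
   at most one neighbour outside the path, joined to [b] by a simple edge. *)
Lemma good_path_extend a (b : 'I_(size Pi)) s : good_path a (b :: s) ->
  (forall k, k \notin b :: s -> dot (p b) (p k) = 0) \/
  exists j, good_path a (j :: b :: s).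
Proof.
case=> us hs horth hpair /= hsum.
case: (boolP [forall k, (k \notin b :: s) ==> (dot (p b) (p k) == 0)]).
  by move/forall_inP => h; left => k /h /eqP.
case/forallPn => j; rewrite negb_imply => /andP[js djb]; right; exists j.
have neb k : k \notin b :: s -> k != b.
  by rewrite inE negb_or => /andP[].
have T0 k : k \notin b :: s -> 0 <= co th k * - cartan (p k) (p b).
  move=> ks; rewrite mulr_ge0 ?neg_cartan_ge0 ?neb //.
  by have := th_coef_ge1 k; lra.
have djb' : dot (p j) (p b) != 0 by rewrite dotC.
have cj := neg_cartan_ge1 (neb _ js) djb'.
have Nj := th_coef_ge1 j.
(* Two outer neighbours of [b] share the total weight 1 that the path allows. *)
have ub k : k \notin b :: s -> k != j ->
    co th j * - cartan (p j) (p b) + co th k * - cartan (p k) (p b) <= 1.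
  move=> ks kj; apply: le_trans hsum; rewrite (bigD1 j) //= lerD2l.
  rewrite (bigD1 k) /=; last by rewrite ks kj.
  by rewrite lerDl; apply: sumr_ge0 => l /andP[/andP[ls _] _]; apply: T0.
have uj : co th j * - cartan (p j) (p b) <= 1.
  apply: le_trans hsum; rewrite (bigD1 j) //= lerDl.
  by apply: sumr_ge0 => l /andP[ls _]; apply: T0.
have Nj1 : co th j = 1 by nra.
have cj1 : cartan (p j) (p b) = -1 by move: uj; rewrite Nj1; lra.
have [Nb1 nb] := hs b (mem_head _ _).
have b0 := simple_neq0 hD hB b; have j0 := simple_neq0 hD hB j.
have dE : 2 * dot (p j) (p b) = - dot (p b) (p b).
  by rewrite -(cartan_dot _ b0) cj1 mulN1r.
(* The coefficient 1 in [th] bounds this norm from below, the edge to [b] from above. *)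
have nj : dot (p j) (p j) = dot th th.
  have h1 : dot th th <= dot (p j) (p j).
    have := coroot_ge hD hB th_pos (i := j); rewrite Nj1 mul1r; apply.
    exact: ltr01.
  have := simple_adj hD hB (neb _ js) djb'; lra.
have cb1 : cartan (p b) (p j) = -1.
  rewrite /cartan dotC dE nb nj mulNr divff // dot_eq0 //; exact: th_neq0.
split.
- by rewrite cons_uniq js.
- by move=> k; rewrite inE => /predU1P[->|/hs].
- move=> i k /= ibs; rewrite inE negb_or => /andP[kj kbs].
  move: ibs; rewrite inE => /predU1P[->|si]; last exact: horth.
  apply/eqP; apply: contraT => d0; have d0' : dot (p k) (p b) != 0 by rewrite dotC.
  have := ub k kbs kj; have := neg_cartan_ge1 (neb _ kbs) d0'.
  have := th_coef_ge1 k; rewrite Nj1 cj1; nra.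
- have h0 (k : nat) : (k < size (b :: s))%N ->
      cartan (p j) (p (nth a (b :: s) k)) * cartan (p (nth a (b :: s) k)) (p j) =
      if k == 0%N then 1 else 0.
    case: k => [|k] hk /=; first by rewrite cj1 cb1 mulrNN mulr1.
    have d0 : dot (p (nth a s k)) (p j) = 0 by apply: horth => //; apply: mem_nth.
    by rewrite /cartan d0 mulr0 mul0r mulr0.
  move=> [|q] [|k] hq hk qk //.
  + by rewrite [nth a _ 0]/= [nth a _ k.+1]/= h0 // eqSS orbF eq_sym.
  + by rewrite [nth a _ 0]/= [nth a _ q.+1]/= mulrC h0 // eqSS orFb eq_sym.
  + by rewrite [nth a _ k.+1]/= [nth a _ q.+1]/= hpair // !eqSS.
(* In the expansion of the nonnegative [cartan th (p j)], [j] contributes 2, [b] contributes -1 and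
   the rest of the path at most 0, so the outer weight is at most 1. *)
- have := cartan_comb hD hB th (p j).
  rewrite (bigID (fun k => k \notin j :: b :: s)) /=.
  under [X in _ -> X <= _]eq_bigr do rewrite mulrN.
  rewrite sumrN => eT.
  have c0 : 0 <= cartan th (p j).
    by rewrite leNgt cartan_lt0 // dotC -leNgt th_dominant.
  suff : \sum_(k | ~~ (k \notin j :: b :: s)) co th k * cartan (p k) (p j) <= 1 by lra.
  rewrite (bigD1 j) /=; last by rewrite mem_head.
  rewrite (bigD1 b) /=; last by rewrite !inE eqxx orbT eq_sym neb.
  rewrite Nj1 Nb1 cb1 cartan_id // !mul1r.
  suff : \sum_(i | (~~ (i \notin [:: j, b & s]) && (i != j)) && (i != b))
             co th i * cartan (p i) (p j) <= 0.
    by lra.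
  apply: sumr_le0 => i /andP[/andP[_ ij] _]; have := neg_cartan_ge0 ij.
  have := th_coef_ge1 i; nra.
Qed.

(** The path [[:: a]] is extended as long as possible. Once no outer vertex is adjacent to it,
    connectedness of the support of [th] makes it the whole diagram. *)
Lemma typeA_of_simple_end a : co th a = 1 -> 0 < dot (p a) th -> typeA Pi.
Proof.
move=> Na da; have a0 := simple_neq0 hD hB a.
have ca : 1 <= cartan th (p a).
  apply: isint_ge1; first exact: (cartan_int hD (simple_root hB a) th_root).
  by rewrite cartan_gt0 // dotC.
(* The coroot bound gives one inequality; the other combines [cartan (p a) th <= 1] with
   [1 <= cartan th (p a)]. *)
have na : dot (p a) (p a) = dot th th.
  case: (eqVneq (p a) th) => [->//|ath].
  have := coroot_ge hD hB th_pos (i := a); rewrite Na mul1r => /(_ ltr01).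
  have := cartan_th_le1 (pos_simple hB a) ath.
  have := cartan_dot (p a) th_neq0; have := cartan_dot th a0.
  have := dot_gt0 a0; have := dot_gt0 th_neq0; rewrite (dotC th (p a)); nra.
have start : good_path a [:: a].
  split=> //.
  - by move=> j; rewrite inE => /eqP ->.
  - by move=> [|q] [|k].
  - have := cartan_comb hD hB th (p a).
    rewrite (bigD1 a) //= Na cartan_id // mul1r.
    under [X in _ -> X <= _]eq_bigr do rewrite mulrN.
    under [X in _ -> X <= _]eq_bigl do rewrite inE.
    by rewrite sumrN; lra.
have [s [b [gs closed]]] : exists s (b : 'I_(size Pi)), good_path a (b :: s) /\
    forall j k, j \in b :: s -> k \notin b :: s -> dot (p j) (p k) = 0.
  (* [N] bounds the number of vertices off the path; at 0 an extension would have more than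
     [size Pi] distinct vertices. *)
  suff H N : forall s (b : 'I_(size Pi)),
      (size Pi <= size (b :: s) + N)%N -> good_path a (b :: s) ->
      exists s (b : 'I_(size Pi)), good_path a (b :: s) /\
      forall j k, j \in b :: s -> k \notin b :: s -> dot (p j) (p k) = 0.
    by apply: (H (size Pi)) start; rewrite leq_addl.
  elim: N => [|N IH] s b hN gs; case: (good_path_extend gs) => [hb|[j gj]].
  - exists s, b; split=> // j k; rewrite inE => /predU1P[->|js]; first exact: hb.
    by case: gs => _ _ h _ _; apply: h.
  - case: gj => /card_uniqP e _ _ _ _; have := max_card (mem (j :: b :: s)).
    by rewrite e card_ord; move: hN => /=; lia.
  - exists s, b; split=> // j k; rewrite inE => /predU1P[->|js]; first exact: hb.
    by case: gs => _ _ h _ _; apply: h.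
  - by apply: (IH (b :: s) j) gj; move: hN => /=; lia.
have full k : k \in b :: s.
  have [] := support_connected hD hB (s := mem (b :: s)) th_pos closed => h;
    apply: h || exfalso.
    by have := th_coef_ge1 k; lra.
  have := h b; rewrite /= mem_head => /(_ _)/negP; apply => //.
  by have := th_coef_ge1 b; lra.
case: gs => us _ _ hpair _.
have perm_s : perm_eq (b :: s) (enum 'I_(size Pi)).
  by apply: uniq_perm => // [|k]; rewrite ?enum_uniq // mem_enum full.
have size_s : size (b :: s) = size Pi by rewrite (perm_size perm_s) size_enum_ord.
exists (fun i => p (nth a (b :: s) i)); split.
  have -> : [seq p (nth a (b :: s) i) | i <- enum 'I_(size Pi)] =
      [seq p i | i <- b :: s].
    rewrite -[in RHS](mkseq_nth a (b :: s)) size_s /mkseq -val_enum_ord -!map_comp.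
    exact: eq_map.
  have e : [seq p i | i <- enum 'I_(size Pi)] = Pi.
    by rewrite -[RHS](mkseq_nth 0 Pi) /mkseq -val_enum_ord -map_comp; apply: eq_map.
  by have := perm_map (fun i => p i) perm_s; rewrite e.
by move=> i j ij; rewrite hpair ?size_s.
Qed.

(** Expanding [cartan th th = 2] over the simple roots gives nonnegative terms. Outside type A the
    term of [a] is already at least 2, so it is the only one. *)
Lemma not_typeA_unique : ~ typeA Pi ->
  exists a, co th a = 2 /\ forall g, cartan g th = co g a.
Proof.
move=> nA.
have ge i := th_coef_ge1 i.
have cge i : 0 <= cartan (p i) th.
  by apply: cartan_th_ge0 => j; apply: (pos_coef_ge0 hB); apply: pos_simple.
have [||a _ da] := dot_gt0_simple hD hB (u := th) (v := th).
- by move=> i; have := ge i; lra.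
- exact/dot_gt0/th_neq0.
have Nne1 i : 0 < dot (p i) th -> co th i != 1.
  by move=> di; apply/eqP => h; apply: nA; apply: typeA_of_simple_end h di.
have a2 : 2 <= co th a.
  apply: isint_ge2 (Nne1 _ da); first exact: (coef_int hB a th_root).
  by have := ge a; lra.
have ca1 : 1 <= cartan (p a) th.
  apply: isint_ge1; first exact: (cartan_int hD th_root (simple_root hB a)).
  by rewrite cartan_gt0 ?th_neq0.
have := cartan_comb hD hB th th; rewrite cartan_id ?th_neq0 // (bigD1 a) //= => e.
have rest0 i : i != a -> 0 <= co th i * cartan (p i) th.
  by move=> _; apply: mulr_ge0 => //; have := ge i; lra.
have rest_ge0 : 0 <= \sum_(i | i != a) co th i * cartan (p i) th by apply: sumr_ge0.
have prod : 2 <= co th a * cartan (p a) th by nra.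
have rest_0 : \sum_(i | i != a) co th i * cartan (p i) th = 0 by lra.
have c0 i : i != a -> cartan (p i) th = 0.
  move=> ia; have := psumr_eq0P rest0 rest_0 ia => /eqP; rewrite mulf_eq0.
  by case/orP => /eqP // h; have := ge i; lra.
have ca : cartan (p a) th = 1 by nra.
exists a; split; first by nra.
move=> g; rewrite (cartan_comb hD hB) (bigD1 a) //= ca mulr1 big1 ?addr0 // => i ia.
by rewrite c0 // mulr0.
Qed.

End HighestRoot.

(** * Shortest elements of the Weyl group *)

Section Words.
Context {R : realFieldType} {n : nat} {D Pi : seq 'rV[R]_n} {th : 'rV[R]_n}.
Hypothesis hD : reduced_root_system D.
Hypothesis hB : is_base D Pi.
Hypothesis hth : highest_root D Pi th.

Implicit Types (b g u v x y z mu : 'rV[R]_n) (i j k : 'I_(size Pi)).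
Implicit Types s t : seq 'rV[R]_n.
Local Notation p i := (Pi`_(nat_of_ord i)).
Local Notation pos := (posroot D Pi).
Local Notation co := (@scoef R n Pi).
Local Notation cle := (@cle R n Pi).

Lemma simple_index b : b \in Pi -> exists i, b = p i.
Proof. by case/(nthP 0) => i hi <-; exists (Ordinal hi). Qed.

Lemma word_root s : {subset s <= Pi} -> {subset s <= D}.
Proof. by case: hB => _ h _ _ hs b /hs /h. Qed.

Lemma word_notin0 s : {subset s <= Pi} -> 0 \notin s.
Proof. by move/word_root; apply: (subset_notin0 hD). Qed.

Lemma actw_simple_root s i : {subset s <= Pi} -> actw s (p i) \in D.
Proof. by move=> hs; apply: (actw_root hD (word_root hs) (simple_root hB i)). Qed.

Lemma word_cons b s : {subset b :: s <= Pi} -> b \in Pi /\ {subset s <= Pi}.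
Proof. by move=> hs; split=> [|x xs]; apply: hs; rewrite ?mem_head // inE xs orbT. Qed.

Lemma cons_word b s : b \in Pi -> {subset s <= Pi} -> {subset b :: s <= Pi}.
Proof. by move=> hb hs x; rewrite inE => /predU1P[->|/hs]. Qed.

(** The exchange condition. Letters act from the right; the letter turning the image of [p i]
    negative must equal that image, and deleting it absorbs the reflection in [p i]. *)
Lemma exchange s i : {subset s <= Pi} -> pos (- actw s (p i)) ->
  exists s', [/\ {subset s' <= Pi}, size s = (size s').+1
    & forall v, actw s (refl (p i) v) = actw s' v].
Proof.
elim: s => [|b s IH] hbs hneg; first by case: (pos_asym hD hB (pos_simple hB i)).
have [bPi hs] := word_cons hbs; have [k ek] := simple_index bPi.
case: (root_sign hD hB (actw_simple_root i hs)) => [hp|/(IH hs)[s' [hs' es' av]]].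
  case: (eqVneq (actw s (p i)) (p k)) => [e|ne].
    exists s; split=> // v; rewrite actw_cons actw_refl ?word_notin0 //.
    by rewrite e ek reflK // (simple_neq0 hD hB).
  by case: (pos_asym hD hB (refl_pos hD hB hp ne)); rewrite -ek.
exists (b :: s'); split; rewrite /= ?es' //; first exact: cons_word.
by move=> v; rewrite -[LHS]/(refl b (actw s (refl (p i) v))) av.
Qed.

(** The last letter acts first and is sent to a negative root by the letters before it; [exchange]
    then yields a word shorter by two with the same action. *)
Lemma actw_id s : {subset s <= Pi} -> (forall i, pos (actw s (p i))) ->
  forall v, actw s v = v.
Proof.
have [N] : exists N, (size s <= N)%N by exists (size s).
elim: N s => [|N IH] s; first by rewrite leqn0 => /nilP ->.
case/lastP: s => // s b hN hs hp.
have bPi : b \in Pi by apply: hs; rewrite mem_rcons mem_head.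
have hs' : {subset s <= Pi} by move=> x xs; apply: hs; rewrite mem_rcons inE xs orbT.
have [k ek] := simple_index bPi; subst b.
have neg : pos (- actw s (p k)).
  by rewrite -actwN -refl_self ?(simple_neq0 hD hB) // -actw_rcons.
have [t [ht st av]] := exchange hs' neg.
have e v : actw (rcons s (p k)) v = actw t v by rewrite actw_rcons av.
move=> v; rewrite e; apply: IH => //; last by move=> i; rewrite -e.
by move: hN; rewrite size_rcons st; lia.
Qed.

Lemma actw_pos s g : {subset s <= Pi} -> pos g ->
  (forall i, 0 < co g i -> pos (actw s (p i))) -> pos (actw s g).
Proof.
move=> hs pg h; apply/(posP hB); split.
  exact: (actw_root hD (word_root hs) (pos_root pg)).
suff ge0 v i : (forall i, 0 <= co v i) -> (forall i, 0 < co v i -> pos (actw s (p i))) ->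
    0 <= co (actw s v) i.
  by move=> i; apply: ge0 => // j; apply: (pos_coef_ge0 hB).
move=> hv hp; rewrite {1}(vec_comb hD hB v) actw_sum.
elim/big_ind: _ => [|x y|k _]; first by rewrite scoef0.
  by rewrite scoefD; apply: addr_ge0.
rewrite actwZ scoefZ; have := hv k; rewrite le_eqVlt => /predU1P[<-|hk].
  by rewrite mul0r.
by apply: mulr_ge0 => //; apply: (pos_coef_ge0 hB); apply: hp.
Qed.

Lemma ht_bound g : g \in D -> exists N : nat, ht (Pi := Pi) th - ht (Pi := Pi) g < N%:R.
Proof.
move=> gD; have [|N hN] := isint_bound (x := ht (Pi := Pi) th - ht (Pi := Pi) g).
  by apply: isintB; apply: (ht_int hB) => //; apply: (th_root hth).
by exists N.+1; apply: le_lt_trans hN _; rewrite ltr_nat.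
Qed.

(** As [th] is no longer than [g], the product of [th - g] with [g] is negative; some simple root
    thus has negative product with [g], and its reflection raises [g] towards [th]. *)
Lemma long_root_word g : pos g -> long_root D g ->
  exists2 s, {subset s <= Pi} & actw s th = g.
Proof.
move=> pg; have thD := th_root hth; have [N] := ht_bound (pos_root pg).
elim: N g pg => [|N IH] g pg hN [gD long].
  by have := cle_ht (th_max hB hth pg); lra.
case: (eqVneq g th) => [->|gth]; first by exists [::].
have hge i : 0 <= co (th - g) i by rewrite scoefB subr_ge0; apply: (th_max hB hth).
have [|i _] := dot_gt0_simple hD hB (v := - g) hge.
  have : 0 < dot (th - g) (th - g) by rewrite dot_gt0 // subr_eq0 eq_sym.
  by have := long th thD; rewrite !dotE2 (dotC g th); lra.
rewrite dotNr oppr_gt0 dotC => di; have i0 := simple_neq0 hD hB i.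
have gi : g != p i by apply: contraTneq di => ->; rewrite -leNgt dot_ge0.
have ci : 1 <= - cartan g (p i).
  apply: isint_ge1; first by apply: isintN; apply: (cartan_int hD (simple_root hB i) gD).
  by rewrite oppr_gt0 cartan_lt0.
have pr := refl_pos hD hB pg gi.
have [||s hs es] := IH _ pr.
- by move: hN; rewrite /refl htD htN htZ (ht_simple hB) mulr1 -natr1; lra.
- by split=> [|b bD]; rewrite ?(pos_root pr) // refl_dot //; apply: long.
exists (p i :: s); first by apply: cons_word => //; apply: mem_nth.
by rewrite actw_cons es reflK.
Qed.

Definition min_word mu s : Prop :=
  [/\ {subset s <= Pi}, actw s th = mu &
      forall t, {subset t <= Pi} -> actw t th = mu -> (size s <= size t)%N].

Lemma min_word_elt mu s : min_word mu s -> min_elt D Pi th mu (actw s).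
Proof.
case=> hs es hmin; split=> //; first by exists s; split=> //; apply: word_root.
exists (size s); split; first by exists s.
by move=> w k _ ew [t [<- ht ewt]]; apply: hmin => //; rewrite -ewt.
Qed.

Lemma min_elt_word mu w : min_elt D Pi th mu w ->
  exists2 s, min_word mu s & forall v, w v = actw s v.
Proof.
case=> _ ew [k [[s [sk hs ws]] hmin]]; exists s => //; split=> //.
  by rewrite -ws.
move=> t ht et; rewrite sk; apply: (hmin (actw t)) => //; last by exists t.
by exists t; split=> //; apply: word_root.
Qed.

Lemma word_indices s : {subset s <= Pi} ->
  exists t : seq 'I_(size Pi), s = [seq p i | i <- t].
Proof.
elim: s => [|b s IH] hs; first by exists [::].
have [/simple_index[i ->] /IH[t ->]] := word_cons hs.
by exists (i :: t).
Qed.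

Lemma indices_word (t : seq 'I_(size Pi)) : {subset [seq p i | i <- t] <= Pi}.
Proof. by move=> x /mapP[i _ ->]; apply: mem_nth. Qed.

Lemma min_word_exists g : pos g -> long_root D g -> exists s, min_word g s.
Proof.
move=> pg /(long_root_word pg)[s hs es].
(* Index tuples of a fixed length form a finite type, which makes [P] boolean and a least length
   available. *)
pose P (k : nat) := [exists t : k.-tuple 'I_(size Pi), actw [seq p i | i <- t] th == g].
have Pword t : {subset t <= Pi} -> actw t th = g -> P (size t).
  move=> /word_indices[u ->] et; rewrite size_map; apply/existsP.
  by exists (in_tuple u); apply/eqP.
have exP : exists k : nat, P k by exists (size s); apply: Pword.
case: (ex_minnP exP) => k /existsP[t /eqP et] hmin.
exists [seq p i | i <- t]; split=> //; first exact: indices_word.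
by move=> u hu eu; rewrite size_map size_tuple; apply: hmin; apply: Pword.
Qed.

(** The reflection in [p i] fixes [th], so a negative image would let [exchange] shorten the
    word. *)
Lemma min_word_orth mu s i : min_word mu s -> dot (p i) th = 0 -> pos (actw s (p i)).
Proof.
case=> hs es hmin d0; case: (root_sign hD hB (actw_simple_root i hs)) => //.
case/(exchange hs) => t [ht st av]; have := hmin t ht.
by rewrite -av refl_orth 1?dotC // st ltnn => /(_ es).
Qed.

Lemma pos_dot_th_ge0 g : pos g -> 0 <= dot g th.
Proof.
move=> pg; rewrite leNgt -(cartan_lt0 _ (th_neq0 hD hth)) -leNgt.
by apply: (cartan_th_ge0 hD hB hth) => i; apply: (pos_coef_ge0 hB).
Qed.

(** Since [th] is dominant, a positive root orthogonal to it involves only simple roots orthogonal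
    to it. *)
Lemma min_word_orth_pos mu s g : min_word mu s -> pos g -> dot g th = 0 ->
  pos (actw s g).
Proof.
move=> hm pg d0; apply: actw_pos => //; first by case: hm.
move=> i gi; apply: min_word_orth hm _.
have h k : true -> 0 <= co g k * dot (p k) th.
  by move=> _; rewrite mulr_ge0 ?(pos_coef_ge0 hB) ?(th_dominant hD hB hth).
have := psumr_eq0P h; rewrite -(dot_comb hD hB) => /(_ d0 i isT) /eqP.
by rewrite mulf_eq0 gt_eqF //= => /eqP.
Qed.

(** The quotient [rev t ++ s] fixes [th]. A simple root made negative by it would be orthogonal to
    [th], as would its image, contradicting the positivity that [s] and [t] preserve on such roots.
    So the quotient is the identity. *)
Lemma min_word_unique mu s t : min_word mu s -> min_word mu t ->
  forall v, actw s v = actw t v.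
Proof.
move=> ms mt; have [hs es _] := ms; have [ht et _] := mt.
have t0 := word_notin0 ht; have s0 := word_notin0 hs.
have hr : {subset rev t <= Pi} by move=> x; rewrite mem_rev; apply: ht.
have hu : {subset rev t ++ s <= Pi} by move=> x; rewrite mem_cat => /orP[/hr|/hs].
have uth : actw (rev t ++ s) th = th by rewrite actw_cat es -et actw_revK.
have id_u : forall v, actw (rev t ++ s) v = v.
  apply: actw_id => // i; have uD := actw_simple_root i hu.
  have du : dot (actw (rev t ++ s) (p i)) th = dot (p i) th.
    by rewrite -{1}uth actw_dot // word_notin0.
  case: (root_sign hD hB uD) => // hneg; exfalso.
  have := pos_dot_th_ge0 hneg; rewrite dotNl du oppr_ge0 => le0.
  have d0 : dot (p i) th = 0 by apply/eqP; rewrite eq_le le0 (th_dominant hD hB hth).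
  have := min_word_orth_pos mt hneg; rewrite dotNl du d0 oppr0 => /(_ erefl).
  rewrite actwN actw_cat actwK //; apply: (pos_asym hD hB).
  exact: min_word_orth ms d0.
by move=> v; rewrite -{2}(id_u v) actw_cat actwK.
Qed.

End Words.

(** * Minimal and maximal abelian ideals *)

Section AbelianIdeals.
Context {R : realFieldType} {n : nat} {D Pi : seq 'rV[R]_n} {th : 'rV[R]_n}.
Hypothesis hD : reduced_root_system D.
Hypothesis hB : is_base D Pi.
Hypothesis hth : highest_root D Pi th.
Variable a : 'I_(size Pi).

Implicit Types (b g u v x y z mu : 'rV[R]_n) (i j k : 'I_(size Pi)).
Implicit Types s t : seq 'rV[R]_n.
Local Notation p i := (Pi`_(nat_of_ord i)).
Local Notation pos := (posroot D Pi).
Local Notation co := (@scoef R n Pi).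
Local Notation cle := (@cle R n Pi).
Local Notation ht := (@ht R n Pi).
Local Notation min_word := (@min_word R n Pi th).

(** Both facts come from [not_typeA_unique]; pairing with the coroot of [th] becomes reading the
    coordinate at [a]. *)
Hypothesis th_a : scoef th a = 2.
Hypothesis cartan_th : forall g, cartan g th = co g a.

Lemma dot_th_gt0 g : (0 < dot g th) = (0 < co g a).
Proof. by rewrite -cartan_th cartan_gt0 ?(th_neq0 hD hth). Qed.

Lemma dot_th_eq0 g : co g a = 0 -> dot g th = 0.
Proof.
move=> h; apply/eqP; have := cartan_dot g (th_neq0 hD hth).
by rewrite cartan_th h mul0r => /esym/eqP; rewrite mulf_eq0 pnatr_eq0.
Qed.

Lemma HsetP g : Hset D Pi th g <-> pos g /\ 0 < co g a.
Proof. by rewrite /Hset dot_th_gt0. Qed.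

Lemma coef_a_eq1 g : pos g -> g != th -> 0 < co g a -> co g a = 1.
Proof.
move=> pg gth ga; have := isint_ge1 (coef_int hB a (pos_root pg)) ga.
have := cartan_th_le1 hD hB hth pg gth; rewrite cartan_th; lra.
Qed.

Lemma coef_a_gt0 g : pos g -> co g a != 0 -> 0 < co g a.
Proof. by move=> pg h; rewrite lt_def h (pos_coef_ge0 hB). Qed.

(** Here [refl th g] is [g - th], so the difference is a root. *)
Lemma th_compl g : pos g -> g != th -> 0 < co g a ->
  [/\ pos (th - g), th - g != th & 0 < co (th - g) a].
Proof.
move=> pg gth ga; have g1 := coef_a_eq1 pg gth ga.
have c1 : 0 < co (th - g) a by rewrite scoefB th_a g1; lra.
split=> //; last first.
  by rewrite -subr_eq0 addrAC subrr add0r oppr_eq0 (pos_neq0 hD pg).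
apply: (pos_of_coef hD hB (i := a)) => //.
rewrite -opprB root_oppE // -[g - th](_ : refl th g = _).
  exact: (root_refl hD (th_root hth) (pos_root pg)).
by rewrite /refl cartan_th g1 scale1r.
Qed.

(** If [g] is inverted, the image of [th - g] lies above [p j]. Conversely, [x] and [th - x] cannot
    both have positive images, since these add up to the simple root [p j]. *)
Lemma IminP j s x : min_word (p j) s ->
  Imin D Pi th (p j) x <-> [/\ pos x, 0 < co x a & pos (actw s x)].
Proof.
move=> ms; have [hs es _] := ms; have pj := pos_simple hB j.
have th_a0 : 0 < co th a by rewrite th_a; lra.
split=> [[->|[w [/(min_elt_word hB)[t mt wt] [g [pg pwg]] ->]]]|[px xa psx]].
- by split; rewrite ?es //; exact: th_pos.
- move: pwg; rewrite wt (min_word_unique hD hB hth mt ms) => nsg.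
  have ga : 0 < co g a.
    apply: coef_a_gt0 => //; apply/eqP => /dot_th_eq0 d0.
    exact: (pos_asym hD hB (min_word_orth_pos hD hB hth ms pg d0)).
  have gth : g != th by apply/eqP => e; move: nsg; rewrite e es; apply: (pos_asym hD hB).
  have [pc _ ca] := th_compl pg gth ga; split=> //.
  have sD : actw s (th - g) \in D by apply: (actw_root hD (word_root hB hs) (pos_root pc)).
  apply: (pos_up hB pj sD) => i; rewrite actwB es scoefD.
  by rewrite lerDl (pos_coef_ge0 hB).
- case: (eqVneq x th) => [->|xth]; first by left.
  have [pc _ ca] := th_compl px xth xa.
  right; exists (actw s); split; first exact: (min_word_elt hB).
  exists (th - x); last by rewrite opprB addrC subrK.
  split=> //; have sD : actw s (th - x) \in D.
    by apply: (actw_root hD (word_root hB hs) (pos_root pc)).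
  case: (root_sign hD hB sD) => // psc.
  by case: (simple_not_sum hD hB (i := j) psx psc); rewrite -actwD addrC subrK es.
Qed.

Lemma Imin_compl j s x : min_word (p j) s ->
  pos x -> x != th -> 0 < co x a ->
  Imin D Pi th (p j) (th - x) <-> ~ Imin D Pi th (p j) x.
Proof.
move=> ms px xth xa; have [pc cth ca] := th_compl px xth xa.
have [hs es _] := ms.
have esum : p j = actw s x + actw s (th - x) by rewrite -actwD addrC subrK es.
split=> [/(IminP _ ms)[_ _ p2] /(IminP _ ms)[_ _ p1]|hx].
  exact: simple_not_sum p1 p2 esum.
apply/(IminP _ ms); split=> //.
have sD : actw s x \in D by apply: (actw_root hD (word_root hB hs) (pos_root px)).
case: (root_sign hD hB sD) => [p1|n1]; first by case: hx; apply/(IminP _ ms).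
have cD : actw s (th - x) \in D by apply: (actw_root hD (word_root hB hs) (pos_root pc)).
apply: (pos_up hB (pos_simple hB j) cD) => i.
by rewrite actwB es scoefD lerDl (pos_coef_ge0 hB).
Qed.

(** Below [th] both coordinates at [a] are 1, so [y - x] combines simple roots orthogonal to [th],
    whose images stay positive. *)
Lemma Imin_up j s x y : min_word (p j) s ->
  Imin D Pi th (p j) x -> pos y -> 0 < co y a -> cle x y -> Imin D Pi th (p j) y.
Proof.
move=> ms ix py ya xy; have [hs es _] := ms.
case: (eqVneq y th) => [->|yth]; first by left.
have [px xa psx] := (IminP x ms).1 ix.
have xth : x != th.
  apply/eqP => e; case/eqP: yth; apply: (cle_anti hD hB); first exact: (th_max hB hth).
  by rewrite -e.
have ea : co (y - x) a = 0.
  by rewrite scoefB (coef_a_eq1 py yth ya) (coef_a_eq1 px xth xa) subrr.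
apply/(IminP _ ms); split=> //.
have sD : actw s y \in D by apply: (actw_root hD (word_root hB hs) (pos_root py)).
apply: (pos_up hB psx sD) => i; rewrite -subr_ge0 -scoefB -actwB.
rewrite (vec_comb hD hB (y - x)) actw_sum.
elim/big_ind: _ => [|u v hu hv|k _]; first by rewrite scoef0.
  by rewrite scoefD; apply: addr_ge0.
rewrite actwZ scoefZ; case: (eqVneq k a) => [->|ka]; first by rewrite ea mul0r.
apply: mulr_ge0; first by rewrite scoefB subr_ge0.
apply: (pos_coef_ge0 hB); apply: (min_word_orth hD hB ms).
by apply: dot_th_eq0; rewrite (coef_simple hB) (negbTE ka).
Qed.

(* If [p a] were in [Imin], then [w] would fix all simple roots, making the
   highest root simple. *)
Lemma Imin_th_sub_a j s : min_word (p j) s ->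
  Imin D Pi th (p j) (th - p a).
Proof.
move=> ms; have [hs es _] := ms.
have ca : co (p a) a = 1 by rewrite (coef_simple hB) eqxx.
apply/(Imin_compl ms); rewrite ?ca ?ltr01 //; first exact: pos_simple.
  by apply/eqP => e; move: ca; rewrite e th_a; lra.
case/(IminP _ ms) => _ _ psa.
have := actw_id hD hB hs _ th; rewrite es => e.
have : co (p j) a = 2.
  rewrite e // => i; case: (eqVneq i a) => [->//|ia].
  apply: (min_word_orth hD hB ms); apply: dot_th_eq0.
  by rewrite (coef_simple hB) (negbTE ia).
by rewrite (coef_simple hB); case: eqP => /= _; lra.
Qed.

(** A negative product of [p i] with a summand gives a root by addition; a positive product of the
    total with a summand gives one by subtraction. If all four tests fail, the square of [g1 + g2]
    is at most 0. *)
Lemma sum_add_simple g1 g2 i : pos g1 -> pos g2 -> g1 + g2 + p i \in D -> g1 + g2 \in D ->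
  g1 + p i \in D \/ g2 + p i \in D.
Proof.
move=> p1 p2 sD gD; have pi := pos_simple hB i; have iD := simple_root hB i.
have [r1 r2] := (pos_root p1, pos_root p2).
case: (ltrP (dot g1 (p i)) 0) => d1.
  by left; apply: (root_add hD) => //; rewrite -addr_eq0 (pos_sum_neq hD hB).
case: (ltrP (dot g2 (p i)) 0) => d2.
  by right; apply: (root_add hD) => //; rewrite -addr_eq0 (pos_sum_neq hD hB).
case: (ltrP 0 (dot (g1 + g2 + p i) g1)) => e1.
  have es : g1 + g2 + p i - g1 = g2 + p i by rewrite -(addrA g1) [LHS]addrC addKr.
  right; rewrite -es; apply: (root_sub hD) => //.
  by rewrite -subr_eq0 es (pos_sum_neq hD hB).
case: (ltrP 0 (dot (g1 + g2 + p i) g2)) => e2.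
  have es : g1 + g2 + p i - g2 = g1 + p i.
    by rewrite (addrC g1) -(addrA g2) [LHS]addrC addKr.
  left; rewrite -es; apply: (root_sub hD) => //.
  by rewrite -subr_eq0 es (pos_sum_neq hD hB).
exfalso; have := dot_gt0 (root_neq0 hD gD).
move: e1 e2; rewrite !dotE2 (dotC g2 g1) !(dotC (p i)); lra.
Qed.

(** An explicit form of [Imax], which is itself a union over all candidate ideals; [ImaxP]
    identifies the two. *)
Definition above_in j x := pos x /\
  forall y, pos y -> 0 < co y a -> cle x y -> Imin D Pi th (p j) y.

Lemma above_in_up j x y : above_in j x -> y \in D -> cle x y -> above_in j y.
Proof.
move=> [px hx] yD xy; split; first exact: (pos_up hB px yD xy).
by move=> z pz za yz; apply: hx => //; apply: cle_trans yz.
Qed.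

(* A sum of two members that is a root can be pushed up, one simple root at a
   time, until it equals [th]; but [Imin] never contains both [g] and [th - g]. *)
Lemma above_in_abelian j s g1 g2 : min_word (p j) s ->
  above_in j g1 -> above_in j g2 -> ~ pos (g1 + g2).
Proof.
move=> ms i1 i2 pg; have [N hN] := ht_bound hB hth (pos_root pg).
elim: N g1 g2 i1 i2 pg hN => [|N IH] g1 g2 i1 i2 pg hN.
  by have := cle_ht (th_max hB hth pg); lra.
have [[p1 h1] [p2 h2]] := (i1, i2).
case: (eqVneq (g1 + g2) th) => [e|ne].
  have e2 : g2 = th - g1 by rewrite -e addrC addKr.
  have n1 : g1 != th.
    by apply/eqP => e1; case/eqP: (pos_neq0 hD p2); rewrite e2 e1 subrr.
  have n2 : g2 != th.
    by rewrite -e -subr_eq0 opprD addrCA subrr addr0 oppr_eq0 (pos_neq0 hD p1).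
  (* Both coordinates at [a] are at most 1 and add up to 2, so both summands lie in [Hset]. *)
  have := cartan_th_le1 hD hB hth p1 n1; have := cartan_th_le1 hD hB hth p2 n2.
  have : co g1 a + co g2 a = 2 by rewrite -scoefD e.
  rewrite !cartan_th => ea c2 c1.
  have a1 : 0 < co g1 a by lra.
  have a2 : 0 < co g2 a by lra.
  have := h2 g2 p2 a2 (@cle_refl _ _ _ _); rewrite e2 => /(Imin_compl ms p1 n1 a1); apply.
  by apply: h1 => //; apply: cle_refl.
have [i [sD _]] := chain_step hD hB pg (th_pos hth) (th_max hB hth pg) ne.
have up g : cle g (g + p i).
  by move=> k; rewrite scoefD lerDl (pos_coef_ge0 hB) //; apply: pos_simple.
have psD := pos_up hB pg sD (up _).
have lt_ht : ht th - ht (g1 + g2 + p i) < N%:R.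
  by rewrite (htD (g1 + g2)) (ht_simple hB); move: hN; rewrite -natr1; lra.
case: (sum_add_simple p1 p2 sD (pos_root pg)) => gD.
  by apply: (IH (g1 + p i) g2) => //; rewrite 1?addrAC //; apply: above_in_up (up _).
by apply: (IH g1 (g2 + p i)) => //; rewrite 1?addrA //; apply: above_in_up (up _).
Qed.

(** Every candidate is closed upwards, hence contained in [above_in j], which is itself a
    candidate. *)
Lemma ImaxP j s x : min_word (p j) s -> Imax D Pi th (p j) x <-> above_in j x.
Proof.
move=> ms; split=> [[I [[_ [Ipos Iup] _ Ihs] Ix]]|hx].
  have px := Ipos x Ix; split=> // y py ya xy; apply/Ihs; split; last exact/HsetP.
  (* An upper ideal is closed only under adding positive roots, so [y] is reached by a chain. *)
  pattern y; apply: (chain_ind hD hB px py xy) => // g i pg _ gD _ Ig.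
  have pi := pos_simple hB i.
  rewrite addrC; apply: Iup => //; rewrite addrC; apply: (pos_up hB pg gD) => k.
  by rewrite scoefD lerDl (pos_coef_ge0 hB).
exists (above_in j); split=> //; split.
- by exists x.
- split=> [g []//|g u hg pu pug]; apply: above_in_up hg (pos_root pug) _ => k.
  by rewrite scoefD lerDr (pos_coef_ge0 hB).
- by move=> g1 g2 h1 h2; apply: above_in_abelian ms h1 h2.
- move=> y; split=> [[[py hy] /HsetP[_ ya]]|iy].
    by apply: hy => //; apply: cle_refl.
  have [py ya _] := (IminP y ms).1 iy.
  split; last exact/HsetP.
  by split=> // z pz za yz; apply: (Imin_up ms iy).
Qed.

(* The common minimum makes the criterion uniform in [j]: a root outside several
   [Imax] is below a single member of [Hset] outside the corresponding [Imin]. *)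
Lemma min_above x : pos x -> co x a = 0 ->
  exists y, [/\ pos y, cle x y, 0 < co y a &
    forall z, pos z -> 0 < co z a -> cle x z -> cle y z].
Proof.
(* The roots of [D] are treated one by one, starting from [th]; [roots_meet] lowers the current
   bound at each relevant root. *)
move=> px xa; suff H (l : seq 'rV[R]_n) : {subset l <= D} ->
    exists y, [/\ pos y, cle x y, 0 < co y a &
      forall z, z \in l -> 0 < co z a -> cle x z -> cle y z].
  have [//|y [py xy ya hy]] := H D; exists y; split=> // z [zD _]; exact: hy.
elim: l => [|z l IH] hl.
  exists th; split=> //; [exact: th_pos | exact: (th_max hB hth) | by rewrite th_a ltr0n].
have [|y [py xy ya hy]] := IH; first by move=> u ul; apply: hl; rewrite inE ul orbT.
have zD : z \in D by apply: hl; rewrite mem_head.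
case: (boolP ((0 < co z a) && [forall i, co x i <= co z i])) =>
    [/andP[za /forallP xz]|nz].
  have pz := pos_up hB px zD xz.
  have [u [pu xu uy uz ua]] := roots_meet hD hB px py pz xy xz xa ya za.
  exists u; split=> // v; rewrite inE => /predU1P[->//|vl] va xv.
  by apply: cle_trans uy _; apply: hy.
exists y; split=> // v; rewrite inE => /predU1P[->|vl] va xv; last exact: hy.
by case/negP: nz; rewrite va; apply/forallP.
Qed.

End AbelianIdeals.

(** * The bijection between minimal and maximal elements *)

Theorem theorem4p3 (R : realFieldType) (n : nat) (D Pi : seq 'rV[R]_n)
  (th : 'rV[R]_n) (S : seq 'rV[R]_n) :
  reduced_root_system D -> irreducible_rs D -> is_base D Pi -> ~ typeA Pi ->
  highest_root D Pi th ->
  S != [::] -> (forall a, a \in S -> a \in Pi /\ long_root D a) ->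
  let A := fun x => forall a, a \in S -> Imin D Pi th a x in
  let B := fun x => posroot D Pi x /\ ~ (exists2 a, a \in S & Imax D Pi th a x) in
  [/\ (forall eta, minimal_in Pi A eta -> maximal_in Pi B (th - eta)),
      (forall eta1 eta2, minimal_in Pi A eta1 -> minimal_in Pi A eta2 ->
         th - eta1 = th - eta2 -> eta1 = eta2)
    & (forall b, maximal_in Pi B b -> exists2 eta, minimal_in Pi A eta & th - eta = b)].
Proof.
move=> hD _ hB nA hth S0 hS A B.
have [a [th_a cth]] := not_typeA_unique hD hB hth nA.
have word m : m \in S -> exists (j : 'I_(size Pi)) s,
    m = Pi`_j /\ min_word (Pi := Pi) (th := th) Pi`_j s.
  move=> /hS[/simple_index[j ->] long]; exists j.
  by have [s ms] := min_word_exists hD hB hth (pos_simple hB j) long; exists s.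
(* A member of [S] forces [A] into [Hset] and keeps [th] out of [B]. *)
have [m0 m0S] : exists m, m \in S.
  by case: (S) S0 => // m l _; exists m; rewrite mem_head.
have A_H x : A x -> posroot D Pi x /\ 0 < scoef x a.
  move=> /(_ _ m0S); have [j [s [-> ms]]] := word _ m0S.
  by case/(IminP hD hB hth th_a cth x ms).
(* On [Hset], each [Imax] coincides with its [Imin]. *)
have B_imin x : posroot D Pi x -> 0 < scoef x a ->
    B x <-> forall m, m \in S -> ~ Imin D Pi th m x.
  move=> px xa; split=> [[_ hx] m mS|hx].
    have [j [s [em ms]]] := word _ mS; rewrite em => ix; apply: hx; exists m => //.
    rewrite em; apply/(ImaxP hD hB hth th_a cth x ms); split=> // y.
    exact: (Imin_up hD hB hth th_a cth ms).
  split=> // -[m mS]; have [j [s [em ms]]] := word _ mS.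
  move=> ix; apply: (hx _ mS); move: ix; rewrite em.
  by case/(ImaxP hD hB hth th_a cth x ms) => _; apply=> //; apply: cle_refl.
have B_th x : B x -> x != th.
  move=> [_ hx]; apply/eqP => e; apply: hx; exists m0 => //.
  have [j [s [-> ms]]] := word _ m0S; rewrite e.
  apply/(ImaxP hD hB hth th_a cth th ms); split=> [|y py _ ty]; first exact: th_pos.
  by left; apply: (cle_anti hD hB) ty; apply: (th_max hB hth).
have A_compl x : posroot D Pi x -> x != th -> 0 < scoef x a -> A x <-> B (th - x).
  move=> px xth xa; have [pc cth' ca] := th_compl hD hB hth th_a cth px xth xa.
  have e : th - (th - x) = x by rewrite opprB addrC subrK.
  split=> [hx|/(B_imin _ pc ca) hx m mS].
    apply/(B_imin _ pc ca) => m mS; have := hx _ mS; have [j [s [-> ms]]] := word _ mS.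
    by rewrite -{1}e => /(Imin_compl hD hB hth th_a cth ms pc cth' ca).
  have := hx _ mS; have [j [s [-> ms]]] := word _ mS.
  by rewrite -{2}e => /(Imin_compl hD hB hth th_a cth ms pc cth' ca).
have subK x y : th - x = y -> x = th - y.
  by move=> <-; rewrite opprB addrC subrK.
split=> [eta [hA hmin]|eta1 eta2 _ _ /subK ->|b [hBb hmax]].
(* [th] is not minimal, since [th - p a] is a smaller member of [A]. *)
- have eth : eta != th.
    apply/eqP => e; have pa := pos_simple hB a.
    have ia : A (th - Pi`_a).
      move=> m mS; have [j [s [-> ms]]] := word _ mS.
      exact: (Imin_th_sub_a hD hB hth th_a cth ms).
    have [pc _] := A_H _ ia.
    have := hmin _ ia; rewrite e => /(_ _)/eqP; rewrite -subr_eq0 addrAC subrr add0r.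
    rewrite oppr_eq0 (negbTE (simple_neq0 hD hB a)) => H; suff : false by [].
    apply: H; apply: (cle_rle hD hB); rewrite ?(pos_root pc) ?(th_root hth) // => i.
    by rewrite scoefB gerBl (pos_coef_ge0 hB).
  have [pe ea] := A_H _ hA.
  have [pc cth' ca] := th_compl hD hB hth th_a cth pe eth ea.
  split; first exact/A_compl.
  move=> y hy le_y; have py := hy.1; have yth := B_th _ hy.
  (* Being above [th - eta], [y] lies in [Hset], so [th - y] is a root of [A] below [eta]. *)
  have ya : 0 < scoef y a by apply: lt_le_trans ca _; apply: (rle_cle hB le_y).
  have [pyc yc yca] := th_compl hD hB hth th_a cth py yth ya.
  have <- : th - y = eta; last by rewrite opprB addrC subrK.
  apply: hmin.
    by apply/A_compl => //; rewrite opprB addrC subrK.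
  apply: (cle_rle hD hB); rewrite ?(pos_root pyc) ?(pos_root pe) // => i.
  by have := rle_cle hB le_y i; rewrite !scoefB; lra.
- by rewrite opprB addrC subrK.
- have pb := hBb.1; have bth := B_th _ hBb.
  (* If [b] were outside [Hset], the least [y] above it in [Hset] would be a larger member of [B]:
     an [Imin] containing [y] contains all of [Hset] above [b], putting [b] in the [Imax]. *)
  have ba : 0 < scoef b a.
    rewrite (coef_a_gt0 hB) //; apply/eqP => b0.
    have [y [py xy ya hy]] := min_above hD hB hth th_a pb b0.
    have hBy : B y.
      apply/(B_imin _ py ya) => m mS; have [j [s [em ms]]] := word _ mS; rewrite em => iy.
      apply: hBb.2; exists m => //; rewrite em.
      apply/(ImaxP hD hB hth th_a cth b ms); split=> // z pz za bz.
      by apply: (Imin_up hD hB hth th_a cth ms iy) => //; apply: hy.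
    have := hmax y hBy (cle_rle hD hB (pos_root pb) (pos_root py) xy).
    by move=> e; move: ya; rewrite e b0 ltxx.
  have [pc cth' ca] := th_compl hD hB hth th_a cth pb bth ba.
  have e : th - (th - b) = b by rewrite opprB addrC subrK.
  exists (th - b) => //; split; first by apply/A_compl => //; rewrite e.
  move=> y hy le_y; have [py ya] := A_H _ hy.
  (* [th] is not below [th - b], because [b] is a positive root. *)
  have yth : y != th.
    apply/eqP => ey; move: le_y; rewrite ey => /(rle_cle hB) h.
    case/eqP: (pos_neq0 hD pb); apply: (coef_inj hD hB) => i.
    have := h i; have := pos_coef_ge0 hB i pb; rewrite scoefB scoef0; lra.
  have [pyc _ _] := th_compl hD hB hth th_a cth py yth ya.
  apply: subK; apply: hmax; first exact/A_compl.
  apply: (cle_rle hD hB); rewrite ?(pos_root pyc) ?(pos_root pb) // => i.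
  by have := rle_cle hB le_y i; rewrite !scoefB; lra.
Qed.
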